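(* Let $\ell,r,k$ be integers with $k\geq 2$, $r\ge 3$, $\ell'\geq r$ and $2\ell'\geq r+7$, where $\ell'=\left\lfloor\frac{\ell+1}{2}\right\rfloor$. Then there exists $N_{\ell,r,k}$ such that for every integer $n>N_{\ell,r,k}$, $$\mathrm{ex}_r(n,\text{Berge-}kP_{\ell})=\binom{k\ell'-1}{r-1}(n-k\ell'+1)+\binom{k\ell'-1}{r}+\mathbb{I}_\ell\cdot\binom{k\ell'-1}{r-2},$$ where $\mathbb{I}_\ell=1$ if $\ell$ is even and $\mathbb{I}_\ell=0$ if $\ell$ is odd.
   Context: An $r$-uniform hypergraph ($r$-graph) is a hypergraph (a vertex set with a set of hyperedges) all of whose hyperedges have exactly $r$ vertices. For a graph $F$, an $r$-graph $\mathcal{B}$ is a Berge-$F$ if $V(F)$ can be identified with a subset of $V(\mathcal{B})$ so that there is a bijection $\phi:E(F)\to E(\mathcal{B})$ with $e\subseteq\phi(e)$ for every $e\in E(F)$. An $r$-graph is Berge-$F$-free if it contains no Berge-$F$ as a subhypergraph. $\mathrm{ex}_r(n,\text{Berge-}F)$ is the maximum number of hyperedges in a Berge-$F$-free $r$-graph on $n$ vertices. $P_\ell$ is the path with $\ell$ edges, and $kP_\ell$ is the graph consisting of $k$ vertex-disjoint copies of $P_\ell$. *)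

(* Defs.v *)
From mathcomp Require Import all_boot.

Set Implicit Arguments.
Unset Strict Implicit.
Unset Printing Implicit Defensive.

(* A hypergraph whose vertex set is the whole finite type T, given by its set
   of hyperedges; isolated vertices are allowed.  Simple graphs are the
   2-uniform ones. *)
Notation hypergraph T := {set {set T}}.

Definition uniform (T : finType) (r : nat) (H : hypergraph T) : bool :=
  [forall e in H, #|e| == r].

(* The vertex i of P_l is joined to its successor: lift ord0 i has value i.+1. *)
Definition path_graph (l : nat) : hypergraph 'I_l.+1 :=
  [set [set widen_ord (leqnSn l) i; lift ord0 i] | i : 'I_l].

(* The copy of V indexed by i : 'I_k is the set of pairs (i, x). *)
Definition disjoint_copies (k : nat) (V : finType) (F : hypergraph V) :
    hypergraph ('I_k * V)%type :=
  [set [set (i, x) | x in e] | i : 'I_k, e : {set V} in F].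

(* f identifies V(F) with a subset of V(B); phi matters only on F, where it is
   a bijection onto B. *)
Definition is_berge (V T : finType) (F : hypergraph V) (B : hypergraph T) :
    bool :=
  [exists f : {ffun V -> T}, exists phi : {ffun {set V} -> {set T}},
    [&& injectiveb f, dinjectiveb phi (mem F), phi @: F == B &
        [forall e in F, f @: e \subset phi e]]].

(* Subhypergraphs may be taken on the whole vertex set, because is_berge does
   not require the identification of V(F) with vertices of B to be onto. *)
Definition berge_free (V T : finType) (F : hypergraph V) (H : hypergraph T) :
    bool :=
  [forall B : hypergraph T, (B \subset H) ==> ~~ is_berge F B].

Definition ex_berge (r n : nat) (V : finType) (F : hypergraph V) : nat :=
  \max_(H : hypergraph 'I_n | uniform r H && berge_free F H) #|H|.

(* Main.v *)
Require Import Defs.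
From mathcomp Require Import all_boot zify.

Set Implicit Arguments.
Unset Strict Implicit.
Unset Printing Implicit Defensive.

(** Put [s = k * l' - 1].

    Lower bound.  Fix a set [U] of [s] vertices and take all the [r]-sets that
    have at most one vertex outside [U]; when [l] is even, add those whose part
    outside [U] is one fixed pair [D].  Two consecutive vertices of a Berge path
    lie in a common hyperedge, so they are not both outside [U], except perhaps
    once, at [D].  Hence each path with [l] edges spends [l'] vertices of [U],
    and [k] disjoint ones would need [k * l' > s] of them
    ([extremal_berge_free]; the family is counted in [card_extremal]).

    Upper bound.  The first step removes the hypergraph.  Choose a set [Q] of
    pairs that maximizes the number of hyperedges with all pairs in [Q], minus
    [#|Q|].  Two applications of Hall's theorem then produce a graph with blue
    edges (those of [Q]) and red edges, each contained in a hyperedge of its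
    own, such that the number of hyperedges is at most the number of blue
    [r]-cliques plus the number of red edges ([red_blue]).  Disjoint paths of
    this graph give a Berge copy ([packing_berge]), so it remains to bound this
    weight for graphs without [k] disjoint paths with [l] edges ([graph_bound]).

    Suppose that the weight exceeds the bound.  Deleting bounded sets of
    vertices that cost less than ['C(s, r - 1)] per vertex only increases the
    excess, and the process stops at a large set [X] ([peeling]).  Inside [X]
    every degree is at least [s], and no set of at most [2 * l'] vertices is
    attached to at most one other vertex: such sets would be too cheap.

    As there is no long path, deleting boundedly many vertices leaves many
    components, and many of these have the same neighbourhood [Y]
    ([many_components]).  Alternating between vertices of [Y] and components
    gives long paths, and the minimum degree makes the pieces inside the
    components longer when [Y] is smaller.  Counting shows that the only way to
    avoid [k] disjoint paths is [#|Y| = s] with single vertices as components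
    ([common_neighbourhood]).  Put [U = Y].  Now [k - 1] disjoint paths can be
    drawn from any [(k - 1) * l'] vertices of [U], so no path with [l] edges
    uses fewer than [l'] vertices of [U].  This excludes every edge outside [U]
    if [l] is odd, and two such edges if [l] is even
    ([structure_of_min_degree]).  So the graph on [X] is contained in the one
    behind the lower bound; each of its edges lies in at least ['C(r, 2)] of the
    [r]-sets counted there, which is why recolouring edges red does not pay
    ([weight_le_extremal]), and the weight is at most the bound after all. *)

(** * Hall's theorem and the reduction to red-blue graphs *)

(** Induction on [D], splitting at a tight nonempty proper subset [S] of [D] if
    there is one: the neighbours of [S] are then needed by [S], and Hall's
    condition survives for the rest.  If every proper subset has slack, any pair can be
    matched first. *)
Lemma hall_marriage (A B : finType) (b0 : B) (N : A -> {set B}) (D : {set A}) :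
    (forall S : {set A}, S \subset D -> #|S| <= #|\bigcup_(a in S) N a|) ->
  exists f : A -> B,
    {in D &, injective f} /\ {in D, forall a, f a \in N a}.
Proof.
have [m] := ubnP #|D|; elim: m N D => // m IHm N D ltDm hallD.
have [->|[a aD]] := set_0Vmem D.
  by exists (fun=> b0); split=> [x y|x]; rewrite inE.
case: (boolP [exists S : {set A},
    [&& S \proper D, S != set0 & #|\bigcup_(x in S) N x| <= #|S|]]).
  case/existsP=> S /and3P[prS S0 tightS].
  have sSD := proper_sub prS.
  have ltS : #|S| < #|D| by apply: proper_card.
  have gtS0 : 0 < #|S| by rewrite card_gt0.
  have cDS : #|D :\: S| = #|D| - #|S|.
    by rewrite cardsD (setIidPr sSD).
  set NS := \bigcup_(x in S) N x in tightS *.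
  have [|S' sS'|f1 [inj1 f1N]] := IHm N S.
  - by apply: leq_trans ltS _.
  - by apply: hallD; apply: subset_trans sS' sSD.
  have [|S' sS'|f2 [inj2 f2N]] := IHm (fun x => N x :\: NS) (D :\: S).
  - by rewrite cDS; lia.
  - have dS : [disjoint S' & S].
      by move: sS'; rewrite subsetD => /andP[].
    have := hallD (S' :|: S).
    rewrite subUset sSD (subset_trans sS' (subsetDl _ _)) => /(_ isT).
    rewrite bigcup_setU -/NS cardsU (disjoint_setI0 dS) cards0 subn0.
    have -> : \bigcup_(x in S') N x :|: NS
              = \bigcup_(x in S') (N x :\: NS) :|: NS.
      apply/setP=> y; rewrite !inE; case yNS: (y \in NS); first by rewrite !orbT.
      rewrite !orbF; apply/bigcupP/bigcupP => [] [x xS' yx]; exists x => //.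
        by rewrite inE yNS.
      by move: yx; rewrite inE yNS.
    have [+ _] := leq_card_setU (\bigcup_(x in S') (N x :\: NS)) NS.
    by move: tightS; clear; lia.
  have inNS x : x \in S -> f1 x \in NS.
    by move=> xS; apply/bigcupP; exists x; rewrite ?f1N.
  have ninNS x : x \in D -> x \notin S -> f2 x \notin NS.
    by move=> xD xS; have := f2N x; rewrite !inE xS xD => /(_ isT)/andP[].
  exists (fun x => if x \in S then f1 x else f2 x); split=> [x y xD yD|x xD].
    case: ifP => xS; case: ifP => yS.
    - exact: inj1.
    - by move=> e; have := ninNS y yD (negbT yS); rewrite -e inNS.
    - by move=> e; have := ninNS x xD (negbT xS); rewrite e inNS.
    - by apply: inj2; rewrite inE ?xS ?yS.
  case: ifP => xS; first exact: f1N.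
  by have := f2N x; rewrite !inE xS xD => /(_ isT)/andP[].
move/existsPn=> slack.
have : 0 < #|N a|.
  by have := hallD [set a]; rewrite sub1set aD big_set1 cards1 => ->.
case/card_gt0P=> b bNa.
have cDa : #|D| = #|D :\ a|.+1 by rewrite (cardsD1 a) aD.
have [|S' sS'|f [injf fN]] := IHm (fun x => N x :\ b) (D :\ a).
- by rewrite cDa in ltDm.
- have [->|S'0] := eqVneq S' set0; first by rewrite cards0.
  have prS' : S' \proper D.
    rewrite properE (subset_trans sS' (subsetDl _ _)).
    by apply: contraL sS' => /subsetP/(_ a aD) aS'; apply/subsetPn; exists a;
      rewrite // !inE eqxx.
  have := slack S'; rewrite prS' S'0 /= -ltnNge => lt.
  have -> : \bigcup_(x in S') (N x :\ b) = (\bigcup_(x in S') N x) :\ b.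
    apply/setP=> y; rewrite !inE; apply/bigcupP/andP=> [[x xS']|[yb /bigcupP[x xS' yx]]].
      by rewrite !inE => /andP[yb yx]; split=> //; apply/bigcupP; exists x.
    by exists x; rewrite // !inE yb.
  by move: lt; rewrite (cardsD1 b (\bigcup_(x in S') N x)); case: (b \in _); lia.
have nb x : x \in D -> x != a -> f x != b.
  by move=> xD xa; have := fN x; rewrite !inE xa xD => /(_ isT)/andP[].
exists (fun x => if x == a then b else f x); split=> [x y xD yD|x xD].
  case: eqP => [->|/eqP xa]; case: eqP => [->|/eqP ya] // e.
  - by have := nb y yD ya; rewrite -e eqxx.
  - by have := nb x xD xa; rewrite e eqxx.
  - by apply: injf; rewrite // !inE ?xa ?ya.
case: eqP => [->//|/eqP xa].
by have := fN x; rewrite !inE xa xD => /(_ isT)/andP[].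
Qed.

Definition pairs (V : finType) (K : {set V}) : {set {set V}} :=
  [set e : {set V} | (e \subset K) && (#|e| == 2)].

(** This is König's theorem for the incidence of hyperedges and pairs, in the
    form used below.  [Q] maximizes the number [ins Q] of hyperedges with all
    pairs in [Q], minus [#|Q|].  Shrinking [Q] does not help, which is Hall's
    condition for matching [Q] into these hyperedges; enlarging it does not
    help, which is Hall's condition for matching the other hyperedges into the
    pairs outside [Q].  The pairs used by the second matching form [R]. *)
Lemma red_blue (V : finType) (H : {set {set V}}) :
  exists (Q R : {set {set V}}) (phi : {set V} -> {set V}),
    [/\ [disjoint Q & R], Q :|: R \subset pairs [set: V],
        {in Q :|: R &, injective phi},
        {in Q :|: R, forall e, phi e \in H /\ e \subset phi e}
      & #|H| <= #|[set K in H | pairs K \subset Q]| + #|R|].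
Proof.
pose P2 := pairs [set: V].
pose ins (Q : {set {set V}}) := [set K in H | pairs K \subset Q].
(* The difference is shifted by [#|P2|] to stay within the naturals. *)
pose h (Q : {set {set V}}) := #|ins Q| + (#|P2| - #|Q|).
have pP2 K : pairs K \subset P2.
  by apply/subsetP=> e; rewrite !inE subsetT => /andP[].
have [Q sQ maxQ] :
    exists2 Q : {set {set V}}, Q \subset P2 &
      forall Q' : {set {set V}}, Q' \subset P2 -> h Q' <= h Q.
  by case: (@arg_maxnP _ set0 (fun Q => Q \subset P2) h (sub0set _)) => Q sQ mQ; exists Q.
have [|f1 [inj1 f1N]] :=
    @hall_marriage _ _ set0 (fun e : {set V} => [set K in ins Q | e \subset K]) Q.
  move=> S sS; set U := \bigcup_(e in S) _.
  have := maxQ (Q :\: S) (subset_trans (subsetDl _ _) sQ).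
  rewrite /h cardsD (setIidPr sS).
  have : ins Q \subset ins (Q :\: S) :|: U.
    apply/subsetP=> K KQ; rewrite in_setU; case: (boolP (K \in ins (Q :\: S))) => //=.
    move: (KQ); rewrite !inE => /andP[-> /subsetP sKQ] /= /subsetPn[e eK].
    rewrite inE (sKQ _ eK) andbT negbK => eS; apply/bigcupP; exists e => //.
    by rewrite inE KQ; move: eK; rewrite inE => /andP[].
  move/subset_leq_card; have [+ _] := leq_card_setU (ins (Q :\: S)) U.
  have := subset_leq_card sS; have := subset_leq_card sQ.
  have arith p q s i i' u w : q <= p -> s <= q -> w <= i' + u -> i <= w ->
    i' + (p - (q - s)) <= i + (p - q) -> s <= u by lia.
  exact: arith.
have [|f2 [inj2 f2N]] :=
    @hall_marriage _ _ set0 (fun K => pairs K :\: Q) (H :\: ins Q).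
  move=> S sS; set U := \bigcup_(K in S) _.
  have sU : U \subset P2.
    by apply/bigcupsP=> K _; apply: subset_trans (subsetDl _ _) (pP2 K).
  have sQU : Q :|: U \subset P2 by rewrite subUset sQ.
  have := maxQ _ sQU; rewrite /h.
  have : ins Q :|: S \subset ins (Q :|: U).
    rewrite subUset; apply/andP; split; apply/subsetP=> K.
      by rewrite !inE => /andP[-> /subset_trans->] //; apply: subsetUl.
    move=> KS; have := subsetP sS K KS; rewrite !inE => /andP[_ ->] /=.
    apply/subsetP=> e eK; rewrite inE; case: (boolP (e \in Q)) => //= eQ.
    by apply/bigcupP; exists K; rewrite // inE eQ.
  move/subset_leq_card; rewrite cardsU.
  have -> : ins Q :&: S = set0.
    apply/setP=> K; rewrite !inE; apply/negP=> /andP[KQ /(subsetP sS)].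
    by rewrite !inE KQ.
  rewrite cards0; have [+ _] := leq_card_setU Q U.
  have := subset_leq_card sQU.
  have arith p q s i i' u w : w <= p -> w <= q + u -> i + s - 0 <= i' ->
    i' + (p - w) <= i + (p - q) -> s <= u by lia.
  exact: arith.
pose R := f2 @: (H :\: ins Q).
pose inv e := odflt set0 [pick K in H :\: ins Q | f2 K == e].
have invP K : K \in H :\: ins Q -> inv (f2 K) = K.
  move=> KH; rewrite /inv; case: pickP => [K' /andP[K'H /eqP]|/(_ K)] /=.
    exact: inj2.
  by rewrite KH eqxx.
have RQ e : e \in R -> e \notin Q.
  by case/imsetP=> K /f2N + ->; rewrite inE => /andP[].
exists Q, R, (fun e => if e \in Q then f1 e else inv e); split.
- rewrite disjoint_sym disjoint_subset.
  by apply/subsetP=> e /RQ; rewrite !inE.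
- rewrite subUset sQ; apply/subsetP=> _ /imsetP[K /f2N KN ->].
  by move: KN; rewrite in_setD => /andP[_]; apply: subsetP (pP2 K) _.
- move=> e e'; rewrite !in_setU.
  case: ifP => eQ; case: ifP => e'Q //=.
  + by move=> _ _; apply: inj1.
  + move=> _ /imsetP[K KD ->]; rewrite invP // => e1.
    by have := f1N e eQ; move: KD; rewrite in_setD e1 !inE => /andP[/negPf->].
  + move=> /imsetP[K KD ->] _; rewrite invP // => e1.
    by have := f1N e' e'Q; move: KD; rewrite in_setD -e1 !inE => /andP[/negPf->].
  + by move=> /imsetP[K KD ->] /imsetP[K' K'D ->]; rewrite !invP // => ->.
- move=> e; rewrite in_setU; case: ifP => [eQ _|eQ /= /imsetP[K KD ->]].
    by have := f1N e eQ; rewrite !inE => /andP[/andP[-> _] ->].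
  have := f2N K KD; rewrite invP // !inE => /andP[_ /andP[-> _]].
  by move: KD; rewrite !inE => /andP[_ ->].
- rewrite card_in_imset // cardsD.
  have /setIidPr -> : ins Q \subset H by apply/subsetP=> K; rewrite inE => /andP[].
  by rewrite -leq_subLR.
Qed.

Lemma copies_pathP k l (e : {set 'I_k * 'I_l.+1}) :
  reflect (exists (i : 'I_k) (j : 'I_l),
             e = [set (i, widen_ord (leqnSn l) j); (i, lift ord0 j)])
          (e \in disjoint_copies k (path_graph l)).
Proof.
apply: (iffP imset2P) => [[i _ _ /imsetP[j _ ->] ->]|[i [j ->]]].
  by exists i, j; rewrite imsetU1 imset_set1.
exists i [set widen_ord (leqnSn l) j; lift ord0 j]; rewrite ?inE //.
  by apply/imsetP; exists j.
by rewrite imsetU1 imset_set1.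
Qed.

(** * Disjoint paths and Berge copies *)

Definition path_packing (V : eqType) (g : rel V) (k l : nat) (ps : seq (seq V)) :=
  [&& size ps == k, all (fun p => (size p == l.+1) && sorted g p) ps
    & uniq (flatten ps)].

Lemma nth_flatten_inj (V : eqType) (x0 : V) (m : nat) (ps : seq (seq V)) i i' j j' :
    uniq (flatten ps) -> all (fun p => size p == m) ps ->
    i < size ps -> i' < size ps -> j < m -> j' < m ->
  nth x0 (nth [::] ps i) j = nth x0 (nth [::] ps i') j' -> i = i' /\ j = j'.
Proof.
elim: ps i i' => // p ps IH i i' /=.
rewrite cat_uniq => /and3P[up /hasPn dis uf] /andP[/eqP sp aps].
have in_flat n : n < size ps -> forall c, c < m ->
    nth x0 (nth [::] ps n) c \in flatten ps.
  move=> ltn c ltc; apply/flattenP; exists (nth [::] ps n); first exact: mem_nth.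
  by apply: mem_nth; rewrite (eqP (allP aps _ (mem_nth _ ltn))).
case: i => [|i]; case: i' => [|i'] //= lti lti' ltj ltj' e.
- split=> //; apply/eqP; rewrite -(nth_uniq x0 _ _ up) ?sp //.
  exact/eqP.
- have := dis _ (in_flat i' lti' j' ltj'); rewrite -e.
  by rewrite mem_nth ?sp.
- have := dis _ (in_flat i lti j ltj); rewrite e.
  by rewrite mem_nth ?sp.
- by have [] := IH i i' uf aps lti lti' ltj ltj' e => -> ->.
Qed.

(** An edge of a path goes to the hyperedge that [phi] reserves for it; since
    [phi] is injective on [E], the hyperedges are distinct. *)
Lemma packing_berge (V : finType) (H E : {set {set V}})
    (phi : {set V} -> {set V}) k l ps : 0 < k ->
    {in E &, injective phi} -> {in E, forall e, phi e \in H /\ e \subset phi e} ->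
    path_packing (fun x y => [set x; y] \in E) k l ps ->
  ~~ berge_free (disjoint_copies k (path_graph l)) H.
Proof.
move=> k_gt0 injphi phiP /and3P[/eqP szps allps uf].
have p0ps : nth [::] ps 0 \in ps by rewrite mem_nth ?szps.
have [x0 _] : exists x0 : V, true.
  by have /andP[] := allP allps _ p0ps; case: (nth _ _ 0) => // x0; exists x0.
pose f (u : 'I_k * 'I_l.+1) := nth x0 (nth [::] ps u.1) u.2.
have szall : all (fun p => size p == l.+1) ps.
  by apply/allP=> p /(allP allps)/andP[].
have injf : injective f.
  move=> [i j] [i' j'] /nth_flatten_inj => /(_ l.+1 uf szall).
  by rewrite szps !ltn_ord => -[] // /val_inj /= -> /val_inj /= ->.
have edgeE (i : 'I_k) (j : 'I_l) :
    [set f (i, widen_ord (leqnSn l) j); f (i, lift ord0 j)] \in E.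
  have /(allP allps)/andP[/eqP + pathp] : nth [::] ps i \in ps.
    by rewrite mem_nth ?szps.
  rewrite /f /= /bump /= add1n; case: (nth [::] ps i) pathp => //= x p pathp [szp].
  by move/(pathP x0): pathp => /(_ j); rewrite szp ltn_ord => /(_ isT).
have imE e : e \in disjoint_copies k (path_graph l) -> f @: e \in E.
  by case/copies_pathP=> i [j ->]; rewrite imsetU1 imset_set1.
apply/forallPn.
exists [set phi (f @: (e : {set _})) | e in disjoint_copies k (path_graph l)].
rewrite negb_imply negbK; apply/andP; split.
  by apply/subsetP=> _ /imsetP[e eF ->]; case: (phiP _ (imE _ eF)).
apply/existsP; exists (finfun f).
apply/existsP; exists [ffun e : {set _} => phi (f @: e)].
have ffE (e : {set _}) : finfun f @: e = f @: e by apply: eq_imset => u; rewrite ffunE.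
apply/and4P; split.
- by apply/injectiveP=> u v; rewrite !ffunE; apply: injf.
- apply/dinjectiveP=> e e' eF e'F; rewrite !ffunE.
  by move/(injphi _ _ (imE _ eF) (imE _ e'F)); apply: imset_inj.
- by apply/eqP; apply: eq_imset => e; rewrite ffunE.
- apply/forallP=> e; apply/implyP=> eF; rewrite ffE ffunE.
  by case: (phiP _ (imE _ eF)).
Qed.

(** * Components and long paths in a set of large minimum degree *)

Definition restr (V : finType) (g : rel V) (C : {set V}) : rel V :=
  [rel x y | [&& x \in C, y \in C & g x y]].

Definition comp (V : finType) (g : rel V) (C : {set V}) (x : V) : {set V} :=
  [set y | connect (restr g C) x y].

Definition nbhd (V : finType) (g : rel V) (C : {set V}) : {set V} :=
  [set y | (y \notin C) && [exists x in C, g x y]].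

Definition connected_in (V : finType) (g : rel V) (T : {set V}) : Prop :=
  {in T &, forall x y, connect (restr g T) x y}.

Definition inner_deg (V : finType) (g : rel V) (T : {set V}) (x : V) : nat :=
  #|[set y in T | g x y]|.

Section Paths.

Variables (V : finType) (g : rel V).
Hypotheses (g_sym : symmetric g) (g_irr : irreflexive g).

Implicit Types (C T Y : {set V}) (x y z : V) (p q : seq V).

Lemma restrE C x y : restr g C x y = [&& x \in C, y \in C & g x y].
Proof. by []. Qed.

Lemma restr_path C x p :
  x \in C -> path (restr g C) x p = path g x p && all (mem C) p.
Proof.
elim: p x => // y p IH x xC /=; rewrite restrE xC /=.
by case yC: (y \in C); rewrite ?andbF //= IH // andbA.
Qed.

Lemma restr_sym C : symmetric (restr g C).
Proof. by move=> x y; rewrite !restrE g_sym andbCA. Qed.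

Lemma comp_refl C x : x \in comp g C x.
Proof. by rewrite inE. Qed.

Lemma comp_sub C x : x \in C -> comp g C x \subset C.
Proof.
move=> xC; apply/subsetP=> y; rewrite inE => /connectP[p + ->].
rewrite restr_path // => /andP[_ /allP allp].
by have := mem_last x p; rewrite inE => /predU1P[->|/allp].
Qed.

Lemma comp_closed C x y z :
  y \in comp g C x -> y \in C -> z \in C -> g y z -> z \in comp g C x.
Proof.
rewrite !inE => xy yC zC gyz; apply: connect_trans xy (connect1 _).
by rewrite restrE yC zC.
Qed.

Lemma comp_eq C x y : y \in comp g C x -> comp g C y = comp g C x.
Proof.
rewrite inE => xy; apply/setP=> z; rewrite !inE.
by rewrite (same_connect (sym_connect_sym (@restr_sym C)) xy).
Qed.

Lemma comp_connected C x : x \in C -> connected_in g (comp g C x).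
Proof.
move=> xC.
suff from_x y : y \in comp g C x -> connect (restr g (comp g C x)) x y.
  move=> y z /from_x xy /from_x; apply: connect_trans.
  by rewrite (sym_connect_sym (@restr_sym _)).
rewrite inE => /connectP[p + ->] {y}; elim/last_ind: p => //= p z IH.
rewrite last_rcons rcons_path => /andP[pp /and3P[lC zC lz]].
have lx : last x p \in comp g C x by rewrite inE; apply/connectP; exists p.
apply: connect_trans (IH pp) (connect1 _).
by rewrite restrE lx (comp_closed lx lC zC lz).
Qed.

Lemma connected_path T x y : connected_in g T -> x \in T -> y \in T ->
  exists p, [/\ path g x p, last x p = y, uniq (x :: p) & {subset x :: p <= T}].
Proof.
move=> conT xT yT; have /connectP[p pp ->] := conT x y xT yT.
case/shortenP: pp => q; rewrite restr_path // => /andP[pq /allP qT] uq _.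
exists q; split=> // z; rewrite inE => /predU1P[->//|]; exact: qT.
Qed.

Lemma path_exits (A : pred V) x p : path g x p -> A x -> ~~ A (last x p) ->
  exists a b, [/\ a \in x :: p, b \in p, A a, ~~ A b & g a b].
Proof.
elim: p x => [|y p IH] x /=; first by move=> _ ->.
case/andP=> gxy pp Ax nAl; case Ay: (A y).
  have [a [b [ap bp Aa Ab gab]]] := IH y pp Ay nAl.
  by exists a, b; split; rewrite // inE ?ap ?bp orbT.
by exists x, y; split; rewrite ?inE ?eqxx ?Ay.
Qed.

Lemma connected_exit T (A : pred V) x y : connected_in g T ->
    x \in T -> y \in T -> A x -> ~~ A y ->
  exists a b, [/\ a \in T, b \in T, A a, ~~ A b & g a b].
Proof.
move=> conT xT yT Ax Ay; have [p [pp lp _ sp]] := connected_path conT xT yT.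
have [|a [b [ap bp Aa Ab gab]]] := path_exits pp Ax; first by rewrite lp.
by exists a, b; split=> //; apply: sp; rewrite // inE bp orbT.
Qed.

(** The last vertex of a path with fewer than [d] other vertices has a
    neighbour off the path, so a path from [z] can be prolonged greedily. *)
Lemma path_of_inner_deg T d z : z \in T ->
    {in T, forall x, d <= inner_deg g T x} ->
  exists p, [/\ path g z p, uniq (z :: p), {subset z :: p <= T} & size p = d].
Proof.
move=> zT degT; suff: forall m, m <= d -> exists p,
    [/\ path g z p, uniq (z :: p), {subset z :: p <= T} & size p = m].
  exact.
elim=> [_|m IH ltmd].
  by exists [::]; split=> // x; rewrite inE => /eqP->.
have [p [pp up sp szp]] := IH (ltnW ltmd).
have lT : last z p \in T by apply/sp/mem_last.
have [y]: exists y, y \in [set y in T | g (last z p) y] :\: [set y in belast z p].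
  apply/set0Pn; rewrite -card_gt0 cardsD subn_gt0.
  apply: leq_trans (degT _ lT).
  apply: leq_ltn_trans (subset_leq_card (subsetIr _ _)) _.
  by rewrite cardsE (leq_ltn_trans (card_size _)) // size_belast szp.
rewrite !inE => /and3P[yb yT gy]; exists (rcons p y); split.
- by rewrite rcons_path pp.
- rewrite -rcons_cons rcons_uniq up andbT lastI mem_rcons inE negb_or yb andbT.
  by apply: contraTneq gy => ->; rewrite g_irr.
- by move=> x; rewrite -rcons_cons mem_rcons inE => /predU1P[->|/sp].
- by rewrite size_rcons szp.
Qed.

(** Pósa's argument.  If no end of the path can be prolonged, the neighbours of
    both ends are on the path, and there are too many of them to avoid a pair
    of crossing chords: [x] is adjacent to the successor of a neighbour of the
    last vertex.  The chords turn the path into a cycle on the same vertices,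
    and an edge leaving the cycle gives the longer path. *)
Lemma extend_path T d p : connected_in g T ->
    {in T, forall x, d <= inner_deg g T x} ->
    sorted g p -> uniq p -> {subset p <= T} -> 0 < size p <= d.*2 ->
    size p < #|T| ->
  exists q, [/\ sorted g q, uniq q, {subset q <= T} & size q = (size p).+1].
Proof.
move=> conT degT; case: p => // x p /= pp up sp szp ltpT.
have xT : x \in T by rewrite sp ?mem_head.
have lT : last x p \in T by apply/sp/mem_last.
case: (boolP [exists y in T, (y \notin x :: p) && (g x y || g (last x p) y)]).
  case/exists_inP=> y yT /andP[yp /orP[gxy|gly]].
    exists (y :: x :: p); split=> //=; first by rewrite g_sym gxy.
      by rewrite yp.
    by move=> z; rewrite inE => /predU1P[->|/sp].
  exists (rcons (x :: p) y); split=> /=.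
  - by rewrite rcons_path pp.
  - by rewrite -[_ && _]/(uniq (rcons (x :: p) y)) rcons_uniq yp.
  - by move=> z; rewrite -rcons_cons mem_rcons inE => /predU1P[->|/sp].
  - by rewrite size_rcons.
(* From here on all the neighbours of both ends are on the path. *)
move/exists_inPn=> stuck.
have inp y u : y \in T -> (u = x) + (u = last x p) -> g u y -> y \in x :: p.
  move=> yT xl guy; apply: contraT => yp; have := stuck y yT; rewrite yp /=.
  by case: xl guy => -> ->; rewrite ?orbT.
pose nt := nth x (x :: p).
pose A := [set i : 'I_(size p) | g x (nt i.+1)].
pose B := [set i : 'I_(size p) | g (last x p) (nt i)].
have dA : d <= #|A|.
  apply: leq_trans (degT x xT) _; rewrite /inner_deg.
  apply: leq_trans (leq_imset_card (fun i : 'I_(size p) => nt i.+1) A).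
  apply/subset_leq_card/subsetP=> y; rewrite inE => /andP[yT gxy].
  have := inp _ _ yT (inl erefl) gxy; rewrite inE => /predU1P[yx|yp].
    by rewrite yx g_irr in gxy.
  have ip : index y p < size p by rewrite index_mem.
  apply/imsetP; exists (Ordinal ip); rewrite ?inE /nt /= nth_index //.
have dB : d <= #|B|.
  apply: leq_trans (degT _ lT) _; rewrite /inner_deg.
  apply: leq_trans (leq_imset_card (fun i : 'I_(size p) => nt i) B).
  apply/subset_leq_card/subsetP=> y; rewrite inE => /andP[yT gly].
  have yp := inp _ _ yT (inr erefl) gly.
  have ip : index y (x :: p) < size p.
    have := yp; rewrite -index_mem /= ltnS leq_eqVlt => /predU1P[e|//].
    have := nth_index x yp; rewrite /= e -/(nth x (x :: p) (size p)) nth_last /=.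
    by move=> yl; rewrite -yl g_irr in gly.
  by apply/imsetP; exists (Ordinal ip); rewrite ?inE /nt /= nth_index.
have [i] : exists i, i \in A :&: B.
  apply/set0Pn; rewrite -card_gt0.
  have := cardsUI A B; have := max_card (A :|: B); rewrite card_ord.
  by move: szp; rewrite -addnn; lia.
rewrite !inE => /andP[gxi gli].
pose p1 := take i p; pose y := nt i.+1; pose p2 := drop i.+1 p.
have dp : p = p1 ++ y :: p2 by rewrite /p1 /y /p2 /nt /= -drop_nth // cat_take_drop.
have lp1 : last x p1 = nt i.
  rewrite /p1 /nt (last_nth x) size_takel 1?ltnW // -[x :: take _ _]/(take i.+1 (x :: p)).
  by rewrite nth_take.
have lp2 : last x p = last y p2 by rewrite dp last_cat.
move: pp; rewrite {1}dp cat_path /= => /and3P[pp1 _ pp2].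
pose c := x :: p1 ++ rev (y :: p2).
have cyc : cycle g c.
  rewrite /c /= rcons_path cat_path pp1 lastI rev_rcons /= rev_path.
  rewrite (eq_path (e' := g)) 1?pp2; last by move=> ? ?; rewrite g_sym.
  rewrite lp1 -lp2 g_sym gli /= last_cat /=.
  suff -> : last (last x p) (rev (belast y p2)) = y by rewrite g_sym.
  by rewrite lp2; case: (p2) => //= z r; rewrite rev_cons last_rcons.
have pc : perm_eq c (x :: p) by rewrite dp /c perm_cons perm_cat2l perm_rev.
have [z zT zp] : exists2 z, z \in T & z \notin x :: p.
  apply/exists_inP; apply: contraTT ltpT => /exists_inPn allT.
  have <- : #|x :: p| = (size p).+1 by apply: (@card_uniqP _ (x :: p)).
  rewrite -leqNgt; apply/subset_leq_card/subsetP=> z /allT.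
  by rewrite negbK.
have [a [b [aT bT ap bp gab]]] := connected_exit (A := mem (x :: p)) conT xT zT (mem_head _ _) zp.
have ac : a \in c by rewrite (perm_mem pc).
have [j r rotc] := rot_to ac.
have pr : perm_eq (a :: r) (x :: p) by rewrite -rotc perm_rot.
exists (b :: a :: r); split=> /=.
- rewrite g_sym gab /=; move: cyc; rewrite -(rot_cycle j) rotc /= rcons_path.
  by case/andP.
- by rewrite -[_ && uniq r]/(uniq (a :: r)) (perm_mem pr) bp (perm_uniq pr).
- by move=> u; rewrite inE (perm_mem pr) => /predU1P[->|/sp].
- by have /= [->] := perm_size pr.
Qed.

Lemma path_of_connected T d m x0 : connected_in g T -> x0 \in T ->
    {in T, forall x, d <= inner_deg g T x} -> m <= d.*2 -> m < #|T| ->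
  exists q, [/\ sorted g q, uniq q, {subset q <= T} & size q = m.+1].
Proof.
move=> conT x0T degT; elim: m => [_ _|m IH ltmd ltmT].
  by exists [:: x0]; split=> // z; rewrite inE => /eqP->.
have [q [pq uq sq szq]] := IH (ltnW ltmd) (ltnW ltmT).
by have := extend_path conT degT pq uq sq; rewrite szq; apply.
Qed.

End Paths.

(** * Many components with a common neighbourhood *)

Definition comps_at (V : finType) (g : rel V) (C Y : {set V}) : {set {set V}} :=
  [set comp g C x | x in C & nbhd g (comp g C x) == Y].

Lemma nbhd_comp (V : finType) (g : rel V) (C : {set V}) x :
  x \in C -> nbhd g (comp g C x) \subset nbhd g C.
Proof.
move=> xC; apply/subsetP=> z; rewrite inE => /andP[zT /exists_inP[y yT gyz]].
have yC := subsetP (comp_sub g xC) _ yT.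
rewrite inE; apply/andP; split; last by apply/exists_inP; exists y.
by apply: contra zT => zC; apply: comp_closed yT yC zC gyz.
Qed.

(** Induction on [t], which bounds the paths starting at one chosen vertex [v]
    of each component.  A large component is replaced by itself minus [v]: each
    of its new components contains a neighbour [w] of [v], and a path starting
    at [w] extends to one starting at [v], so that [t] drops by one while the outer neighbourhood
    grows by [v] only.  If all components are small, there are many of them,
    and the pigeonhole principle applies to their neighbourhoods, which are
    subsets of a set of at most [p] vertices.  The bound [N] is uniform in the
    graph. *)
Lemma many_components (t p M : nat) : exists N : nat,
  forall (V : finType) (g : rel V) (C : {set V}), symmetric g ->
    #|nbhd g C| <= p ->
    (forall x, x \in C -> exists2 v, v \in comp g C x &
       forall q, path (restr g C) v q -> uniq (v :: q) -> size q < t) ->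
    N <= #|C| ->
  exists C' Y : {set V}, C' \subset C /\ M <= #|comps_at g C' Y|.
Proof.
elim: t p => [|t IH] p.
  exists 1 => V g C _ _ short /card_gt0P[x xC].
  by have [v _ /(_ [::] isT isT)] := short x xC.
have [N1 IHN] := IH p.+1.
exists (2 ^ p * M * N1.+1).+1 => V g C g_sym pC short ltC.
case: (boolP [exists x in C, N1 < #|comp g C x|]) => [|/exists_inPn small].
  case/exists_inP=> x xC big; have [v vT shortv] := short x xC.
  have vC : v \in C := subsetP (comp_sub g xC) v vT.
  set T := comp g C x in big vT; pose C1 := T :\ v.
  have sTC : T \subset C := comp_sub g xC.
  have sC1 : C1 \subset C := subset_trans (subsetDl _ _) sTC.
  have [||||C' [Y [sC' MY]]] := IHN V g C1; last first.
  - by exists C', Y; split=> //; apply: subset_trans sC' sC1.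
  - by move: big; rewrite (cardsD1 v) vT.
  - move=> z /setD1P[zv zT].
    have [q [pq lq uq sq]] := connected_path (comp_connected g_sym xC) vT zT.
    case: q pq lq uq sq => [_ e|w q]; first by rewrite -e eqxx in zv.
    move=> /= /andP[gvw pq] lq /andP[vq uq] sq.
    have sqC1 u : u \in w :: q -> u \in C1.
      move=> uwq; rewrite in_setD1 (sq u) ?andbT; last by rewrite in_cons uwq orbT.
      by apply: contraNneq vq => <-.
    have wC1 := sqC1 w (mem_head _ _).
    exists w.
      rewrite inE (sym_connect_sym (@restr_sym _ _ g_sym _)); apply/connectP; exists q => //.
      rewrite restr_path // pq; apply/allP=> u uq'; apply: sqC1.
      by rewrite inE uq' orbT.
    move=> r; rewrite restr_path // => /andP[pr /allP rC1] ur.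
    rewrite -ltnS -[(size r).+1]/(size (w :: r)); apply: shortv.
      rewrite restr_path //= gvw pr (subsetP sC1) //=.
      by apply/allP=> u /rC1/(subsetP sC1).
    apply/andP; split; last exact: ur.
    apply/negP; rewrite inE => /predU1P[e|/rC1].
      by move: wC1; rewrite -e !inE eqxx.
    by rewrite /= !inE eqxx.
  - apply: leq_trans (_ : #|v |: nbhd g C| <= _); last first.
      by rewrite cardsU1; case: (_ \notin _); lia.
    apply/subset_leq_card/subsetP=> z.
    rewrite [z \in nbhd g C1]inE in_setU1 in_setD1 negb_and negbK.
    case/andP=> /orP[->//|zT] /exists_inP[y /setD1P[_ yT] gyz].
    apply/orP; right; have : z \in nbhd g T.
      by rewrite inE zT; apply/exists_inP; exists y.
    exact: (subsetP (nbhd_comp g xC)).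
  - by [].
case: (boolP [exists Y in powerset (nbhd g C), M <= #|comps_at g C Y|]).
  by case/exists_inP=> Y _ MY; exists C, Y.
move/exists_inPn=> few; exfalso; move: ltC; apply/negP; rewrite -leqNgt.
pose P := comp g C @: C.
have leC : #|C| <= #|P| * N1.
  apply: leq_trans (_ : \sum_(T in P) #|T| <= _).
    apply: leq_trans (leq_card_cover P); apply/subset_leq_card/subsetP=> x xC.
    by apply/bigcupP; exists (comp g C x); [apply: imset_f|apply: comp_refl].
  rewrite -sum_nat_const; apply: leq_sum => _ /imsetP[x xC ->].
  by rewrite leqNgt small.
suff leP : #|P| <= 2 ^ p * M.
  by apply: leq_trans leC _; rewrite leq_mul.
rewrite -sum1_card (partition_big (nbhd g) (mem (powerset (nbhd g C)))) /=; last first.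
  by move=> _ /imsetP[x xC ->]; rewrite powersetE nbhd_comp.
apply: leq_trans (_ : \sum_(Y in powerset (nbhd g C)) M <= _).
  apply: leq_sum => Y /few; rewrite -ltnNge => /ltnW; apply: leq_trans.
  rewrite sum1_card; apply/subset_leq_card/subsetP=> T.
  rewrite unfold_in => /andP[/imsetP[x xC ->] nx].
  by apply/imsetP; exists x; rewrite // inE xC.
by rewrite sum_nat_const card_powerset leq_mul // leq_exp2l.
Qed.

(** * Threading paths through connectors *)

Definition covered (V : finType) (Ts : seq {set V}) : pred V :=
  fun x => has (fun T : {set V} => x \in T) Ts.

Definition pairwise_disjoint (V : finType) (Ts : seq {set V}) : bool :=
  pairwise (fun A B : {set V} => [disjoint A & B]) Ts.

Definition connector (V : finType) (g : rel V) (Y T : {set V}) : Prop :=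
  [/\ connected_in g T, [disjoint T & Y]
    & {in Y, forall y, exists2 z, z \in T & g y z}].

Section Packing.

Variables (V : finType) (g : rel V).
Hypotheses (g_sym : symmetric g) (g_irr : irreflexive g).

Implicit Types (T Y : {set V}) (Ts : seq {set V}) (p : seq V).

Lemma disjoint_not_covered T Ts x :
  all (fun B : {set V} => [disjoint T & B]) Ts -> x \in T -> ~~ covered Ts x.
Proof.
move=> /allP dis xT; apply/hasPn=> B /dis; rewrite disjoint_subset.
by move/subsetP/(_ x xT).
Qed.

(** Between two consecutive vertices of [y :: ys] the path crosses one of the
    sets [Ts], using at least one of its vertices; hence the factor 2. *)
Lemma zigzag Y y ys Ts :
    size Ts = size ys -> uniq (y :: ys) -> {subset y :: ys <= Y} ->
    pairwise_disjoint Ts -> {in Ts, forall T, connector g Y T} ->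
  exists p, [/\ path g y p, last y p = last y ys, uniq (y :: p),
    (size ys).*2 <= size p & {in p, forall x, (x \in ys) || covered Ts x}].
Proof.
elim: ys y Ts => [|y2 ys IH] y [|T Ts] //=; first by exists [::].
move=> [szT] /andP[yys uys] sY /andP[disT disTs] conTs.
have sY2 : {subset y2 :: ys <= Y} by move=> x xys; apply: sY; rewrite inE xys orbT.
have [|p [pp lp up szp sp]] := IH y2 Ts szT uys sY2 disTs.
  by move=> S STs; apply: conTs; rewrite inE STs orbT.
have [conT dTY adjT] := conTs T (mem_head _ _).
have [z1 z1T gyz1] := adjT y (sY _ (mem_head _ _)).
have [z2 z2T gyz2] := adjT y2 (sY2 _ (mem_head _ _)).
have [q [pq lq uq sq]] := connected_path conT z1T z2T.
have TY x : x \in Y -> x \in T -> False.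
  by move=> xY xT; move: dTY; rewrite disjoint_subset => /subsetP/(_ x xT)/negP.
have cY x : x \in Y -> ~~ covered Ts x.
  move=> xY; apply/hasPn=> S STs.
  have /conTs[_ + _] : S \in T :: Ts by rewrite inE STs orbT.
  by rewrite disjoint_sym disjoint_subset => /subsetP/(_ x xY).
have dq x : x \in z1 :: q -> x \notin y2 :: p.
  move=> /sq xT; apply/negP; rewrite inE => /predU1P[xy|/sp/orP[xys|]].
  - by apply: (TY x) => //; rewrite xy sY2 ?mem_head.
  - by apply: (TY x) => //; rewrite sY2 // inE xys orbT.
  - by apply/negP; apply: disjoint_not_covered disT xT.
exists (z1 :: q ++ y2 :: p); split.
- by rewrite /= gyz1 cat_path pq /= lq g_sym gyz2.
- by rewrite /= last_cat.
- apply/andP; split; last first.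
    rewrite -[uniq _]/(uniq ((z1 :: q) ++ y2 :: p)) cat_uniq uq up andbT.
    by apply/hasPn=> x; apply: contraL => /dq.
  rewrite -cat_cons mem_cat negb_or; apply/andP; split.
    by apply/negP=> /sq; apply: TY; apply: sY; rewrite mem_head.
  apply: contra yys; rewrite inE => /predU1P[->|/sp/orP[yys|]].
  + exact: mem_head.
  + by rewrite inE yys orbT.
  + by move=> cy; have := cY y (sY _ (mem_head _ _)); rewrite cy.
- by rewrite doubleS /= size_cat /= addnS !ltnS (leq_trans szp) ?leq_addl.
- move=> x; rewrite -cat_cons mem_cat [_ \in y2 :: p]inE => /or3P[/sq xT|/eqP->|/sp].
  + by rewrite /covered /= xT orbT.
  + by rewrite mem_head.
  + by rewrite /covered inE /=; case/orP=> ->; rewrite ?orbT.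
Qed.

Lemma path_with_ends Y y ys Ts f b :
    size Ts = size ys -> uniq (y :: ys) -> {subset y :: ys <= Y} ->
    pairwise_disjoint Ts -> {in Ts, forall T, connector g Y T} ->
    path g y f -> path g (last y ys) b -> uniq (f ++ b) ->
    {in f ++ b, forall x, (x \notin Y) && ~~ covered Ts x} ->
  exists P, [/\ sorted g P, uniq P, size f + size b + (size ys).*2 < size P &
    {in P, forall x, [|| x \in f ++ b, x \in y :: ys | covered Ts x]}].
Proof.
move=> szT uys sY disTs conTs pf pb ufb fb_out.
have [p [pp lp up szp sp]] := zigzag szT uys sY disTs conTs.
have spx x : x \in y :: p -> (x \in y :: ys) || covered Ts x.
  by rewrite !inE => /predU1P[->|/sp/orP[->|->]]; rewrite ?eqxx ?orbT.
have yp_out x : x \in f ++ b -> x \notin y :: p.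
  move=> /fb_out/andP[xY xTs]; apply/negP=> /spx; rewrite (negPf xTs) orbF.
  by move/sY; rewrite (negPf xY).
exists (rev f ++ y :: p ++ b); split.
- rewrite sorted_cat_cons -rev_cons rev_sorted cat_path pp lp pb !andbT.
  by rewrite /= (eq_path (e' := g)) // => u v; apply: g_sym.
- rewrite -cat_cons uniq_catCA cat_uniq up /= -(uniq_catC b) -(uniq_catC (rev f)).
  rewrite (perm_uniq (_ : perm_eq (rev f ++ b) (f ++ b))) ?perm_cat2r ?perm_rev //.
  rewrite ufb andbT; apply/hasPn=> x; rewrite mem_cat mem_rev -mem_cat.
  exact: yp_out.
- rewrite size_cat size_rev /= size_cat addnS ltnS -addnA leq_add2l addnC.
  by rewrite leq_add2r.
- move=> x; rewrite -cat_cons mem_cat mem_rev [x \in (y :: p) ++ b]mem_cat mem_cat.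
  by case/or3P=> [->//|/spx/orP[]->|->]; rewrite ?orbT.
Qed.

(** Each path uses [a] vertices of [Y] and [a + 1] connectors: one between any
    two consecutive vertices of [Y], and one at each end, where the minimum
    degree provides a piece of [d + 1] vertices.  This makes at least
    [2 * (d + 1) + 2 * a - 1] vertices. *)
Lemma path_packing_of_connectors Y ys Ts a d k l :
    0 < a -> l <= d.*2 + a.*2 -> uniq ys -> {subset ys <= Y} ->
    k * a <= size ys -> k * a.+1 <= size Ts -> pairwise_disjoint Ts ->
    {in Ts, forall T, connector g Y T} ->
    {in Ts, forall T : {set V}, {in T, forall x, d <= inner_deg g T x}} ->
  exists ps, path_packing g k l ps
          /\ {in flatten ps, forall x, (x \in ys) || covered Ts x}.
Proof.
case: a => // a _ lel; elim: k ys Ts => [|k IH] ys Ts uys sY szys szTs disTs conTs degTs.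
  by exists [::].
have szy : size (take a.+1 ys) = a.+1 by rewrite size_takel //; lia.
have szT : size (take a.+2 Ts) = a.+2 by rewrite size_takel //; lia.
have := cat_take_drop a.+1 ys; have := cat_take_drop a.+2 Ts.
case: (take a.+1 ys) szy => // y ys1 [szys1].
case: (take a.+2 Ts) szT => // T [] // T' Ts1 [szTs1].
set ys2 := drop a.+1 ys; set Ts2 := drop a.+2 Ts => defTs defys.
have sys2 : {subset ys2 <= ys} by move=> x; apply: mem_drop.
have sTs2 : {subset Ts2 <= Ts} by move=> x; apply: mem_drop.
have sys1 : {subset y :: ys1 <= ys} by move=> x xy; rewrite -defys mem_cat xy.
have sTs1 : {subset [:: T, T' & Ts1] <= Ts} by move=> x xy; rewrite -defTs mem_cat xy.
have szys2 : k * a.+1 <= size ys2 by rewrite size_drop; lia.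
have szTs2 : k * a.+2 <= size Ts2 by rewrite size_drop; lia.
have := uys; rewrite -{1}defys cat_uniq => /and3P[uys1 /hasPn dys uys2].
have := disTs; rewrite -{1}defTs /pairwise_disjoint pairwise_cat.
case/and3P=> dis12 disTs1 disTs2.
have [|||ps [/and3P[/eqP szps allps ups] sps]] :=
    IH ys2 Ts2 uys2 _ szys2 szTs2 disTs2.
- by move=> x /sys2/sY.
- by move=> S /sTs2/conTs.
- by move=> S /sTs2/degTs.
have TTs : T \in Ts by apply: sTs1; rewrite inE eqxx.
have T'Ts : T' \in Ts by apply: sTs1; rewrite !inE eqxx orbT.
have [_ dTY adjT] := conTs T TTs; have [_ dT'Y adjT'] := conTs T' T'Ts.
have [z zT gyz] := adjT y (sY _ (sys1 _ (mem_head _ _))).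
have [z' z'T gyz'] := adjT' (last y ys1) (sY _ (sys1 _ (mem_last _ _))).
have [f [pf uf sf szf]] := path_of_inner_deg g_irr zT (degTs T TTs).
have [b [pb ub sb szb]] := path_of_inner_deg g_irr z'T (degTs T' T'Ts).
move: disTs1 => /= /andP[/andP[dTT' dTTs1] /andP[dT'Ts1 disTs1]].
have outY S x : S \in Ts -> x \in S -> x \notin Y.
  move=> STs xS; have [_ + _] := conTs S STs.
  by rewrite disjoint_subset => /subsetP/(_ x xS).
have [|||||||P [sP uP szP inP]] :=
  @path_with_ends Y y ys1 Ts1 (z :: f) (z' :: b) _ uys1 _ disTs1 _ _ _.
- by rewrite szTs1 szys1.
- by move=> x /sys1/sY.
- by move=> S STs; apply: conTs; apply: sTs1; rewrite !inE STs !orbT.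
- by rewrite /= gyz.
- by rewrite /= gyz'.
- rewrite cat_uniq uf ub andbT; apply/hasPn=> x /sb xT'; apply: contraL xT' => /sf xT.
  by move: dTT'; rewrite disjoint_subset => /subsetP/(_ x xT).
- move=> x; rewrite mem_cat => /orP[/sf xS|/sb xS].
    by rewrite (outY T) //= (disjoint_not_covered dTTs1).
  by rewrite (outY T') //= (disjoint_not_covered dT'Ts1).
have inP' x : x \in P -> (x \in y :: ys1) || covered [:: T, T' & Ts1] x.
  move/inP; rewrite mem_cat /covered /= => /or3P[/orP[/sf->|/sb->]|->|->] //;
  by rewrite ?orbT.
exists (take l.+1 P :: ps); split.
  apply/and3P; split=> /=; first by rewrite szps.
    rewrite allps take_sorted // size_takel ?eqxx //.
    by move: szP lel; rewrite /= szf szb szys1; clear; lia.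
  rewrite cat_uniq take_uniq // ups andbT; apply/hasPn=> x /sps xps.
  apply/negP=> /mem_take/inP'/orP[xys|/hasP[S STs xS]]; case/orP: xps => [xys2|].
  + by have := dys x xys2; rewrite xys.
  + case/hasP=> S STs xS; have := outY S x (sTs2 _ STs) xS.
    by rewrite (sY _ (sys1 _ xys)).
  + by have := outY S x (sTs1 _ STs) xS; rewrite (sY _ (sys2 _ _)).
  + case/hasP=> S' S'Ts xS'; have /allrelP/(_ S S' STs S'Ts) := dis12.
    by rewrite disjoint_subset => /subsetP/(_ x xS); rewrite inE /= xS'.
move=> x; rewrite /= mem_cat => /orP[/mem_take/inP'|/sps] /orP[xys|].
- by apply/orP; left; apply: sys1.
- by case/hasP=> S STs xS; apply/orP; right; apply/hasP; exists S; rewrite ?sTs1.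
- by apply/orP; left; apply: sys2.
- by case/hasP=> S STs xS; apply/orP; right; apply/hasP; exists S; rewrite ?sTs2.
Qed.

End Packing.

(** * A common neighbourhood of the right size *)

Lemma packing_of_disjoint_paths (V : finType) (g : rel V) k l (Ts : seq {set V}) :
    k <= size Ts -> pairwise_disjoint Ts ->
    {in Ts, forall T : {set V}, exists q,
       [/\ sorted g q, uniq q, {subset q <= T} & size q = l.+1]} ->
  exists ps, path_packing g k l ps /\ {in flatten ps, forall x, covered Ts x}.
Proof.
elim: k Ts => [|k IH] [|T Ts] //=; [by exists [::]|by exists [::]|].
move=> ltk /andP[disT disTs] paths.
have [|ps [/and3P[/eqP szps allps ups] sps]] := IH Ts ltk disTs.
  by move=> S STs; apply: paths; rewrite inE STs orbT.
have [q [sq uq qT szq]] := paths T (mem_head _ _).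
exists (q :: ps); split.
  apply/and3P; split=> /=; rewrite ?szps ?szq ?eqxx ?sq //.
  rewrite cat_uniq uq ups andbT; apply/hasPn=> x /sps; apply: contraL => /qT.
  exact: disjoint_not_covered.
move=> x; rewrite /= mem_cat => /orP[/qT xT|/sps cx].
  by rewrite /covered /= xT.
by rewrite /covered /=; apply/orP; right.
Qed.

Lemma comps_at_connectors (V : finType) (g : rel V) (C Y : {set V})
    (F : {set {set V}}) : symmetric g -> F \subset comps_at g C Y ->
  pairwise_disjoint (enum F) /\ {in enum F, forall T, connector g Y T}.
Proof.
move=> g_sym /subsetP sF; split.
  have : pairwise [rel x y | x != y] (enum F) by rewrite -uniq_pairwise enum_uniq.
  apply: (@sub_in_pairwise _ (mem F)); last by apply/allP=> T; rewrite mem_enum.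
  move=> T S /sF/imsetP[x _ ->] /sF/imsetP[y _ ->] /=; apply: contraR.
  case/pred0Pn=> z /andP[/(comp_eq g_sym) <- /(comp_eq g_sym) <-].
  by rewrite eqxx.
move=> T; rewrite mem_enum => /sF/imsetP[x]; rewrite inE => /andP[xC /eqP nY] ->.
split; first exact: comp_connected.
  rewrite -nY disjoint_sym disjoint_subset; apply/subsetP=> z.
  by rewrite inE => /andP[].
move=> y; rewrite -{1}nY inE => /andP[_ /exists_inP[z zT gzy]].
by exists z; rewrite // g_sym.
Qed.

(** A set violating this condition is attached to the rest of the graph through
    at most one vertex; such sets are excluded because too few cliques meet
    them. *)
Definition no_blob (V : finType) (g : rel V) (X : {set V}) (m : nat) : Prop :=
  forall T Y : {set V}, T \subset X -> T != set0 ->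
    #|T| <= m -> nbhd g T \subset Y -> 1 < #|Y|.

Section CommonNeighbourhood.

Variables (V : finType) (g : rel V) (X : {set V}) (k l l' : nat).
Hypotheses (g_sym : symmetric g) (g_irr : irreflexive g).
Hypothesis g_in_X : forall x y, g x y -> y \in X.
Hypotheses (k_gt1 : 1 < k) (l'_gt2 : 2 < l') (le_l : l <= l'.*2).
Hypothesis min_deg : {in X, forall x, k * l' - 1 <= #|[set y | g x y]|}.
Hypothesis no_packing : forall ps, ~~ path_packing g k l ps.
Hypothesis noblob : no_blob g X l'.*2.

Lemma inner_deg_ge (T : {set V}) x : x \in T -> T \subset X ->
  k * l' - 1 - #|nbhd g T| <= inner_deg g T x.
Proof.
move=> xT TX; rewrite leq_subLR; apply: leq_trans (min_deg (subsetP TX x xT)) _.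
rewrite addnC; have [+ _] := leq_card_setU [set y in T | g x y] (nbhd g T).
apply: leq_trans; apply/subset_leq_card/subsetP=> y; rewrite !inE => gxy.
rewrite gxy andbT; case yT: (y \in T) => //=; apply/exists_inP.
by exists x.
Qed.

Lemma comps_at_few (C Y : {set V}) (F : {set {set V}}) a d :
    F \subset comps_at g C Y -> 0 < a -> l <= d.*2 + a.*2 -> k * a <= #|Y| ->
    {in F, forall T : {set V}, {in T, forall x, d <= inner_deg g T x}} ->
  #|F| < k * a.+1.
Proof.
move=> sF a_gt0 lel leY degF; rewrite ltnNge; apply/negP=> leF.
have [dis con] := comps_at_connectors g_sym sF.
have [||||ps [/(negP (no_packing ps))]] //=
  := path_packing_of_connectors (k := k) g_sym g_irr a_gt0 lel
       (enum_uniq (mem Y)) (Y := Y) _ _ _ dis con.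
- by move=> x; rewrite mem_enum.
- by rewrite -cardE.
- by rewrite -cardE.
- by move=> T; rewrite mem_enum => /degF.
Qed.

(** Inside these components all degrees are at least [d], the larger of 1 and
    [k * l' - 1 - #|Y|].  As [d + a >= l'], paths with [a] vertices of [Y] are
    long enough, and [Y] has room for [k] of them: [k * d > d] because [k > 1].
    The exception is [#|Y| < k], when some path would get no vertex of [Y].
    Then [d >= k * (l' - 1)], so that [l <= 2 * d], and by Pósa's argument each
    component contains a path with [l] edges or has at most [l] vertices.  The
    latter is impossible for [k > 2], since then [d >= 2 * l'], and for [k = 2]
    it is what [no_blob] excludes. *)
Lemma few_large_comps (C Y : {set V}) : C \subset X -> #|Y| < k * l' ->
  #|[set T in comps_at g C Y | 1 < #|T|]| < k * l'.+1.
Proof.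
move=> CX ltY; set F := [set T in _ | _].
have sF : F \subset comps_at g C Y by apply/subsetP=> T; rewrite inE => /andP[].
have FP T : T \in F ->
    [/\ T \subset X, connected_in g T, nbhd g T = Y & 1 < #|T|].
  rewrite inE => /andP[/imsetP[x]]; rewrite inE => /andP[xC /eqP nT -> T1].
  split=> //; last exact: comp_connected.
  exact: subset_trans (comp_sub g xC) CX.
pose d := maxn 1 (k * l' - 1 - #|Y|).
have degF : {in F, forall T : {set V}, {in T, forall x, d <= inner_deg g T x}}.
  move=> T /FP[TX conT nT T1] x xT; rewrite /d geq_max -nT inner_deg_ge // andbT.
  have [y yT yx] : exists2 y, y \in T & y != x.
    have /card_gt0P[y] : 0 < #|T :\ x| by move: T1; rewrite (cardsD1 x) xT.
    by case/setD1P; exists y.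
  have [a [b [_ bT /eqP-> _ gab]]] :=
    connected_exit (A := pred1 x) conT xT yT (eqxx x) yx.
  by apply/card_gt0P; exists b; rewrite inE bT.
pose a := maxn 1 (l' - d).
have [leY|gtY] := leqP (k * a) #|Y|.
  have a_gt0 : 0 < a by rewrite leq_maxl.
  have lel : l <= d.*2 + a.*2 by rewrite /a; move: le_l; clear; lia.
  apply: leq_trans (comps_at_few sF a_gt0 lel leY degF) _.
  rewrite leq_mul2l; apply/orP; right; rewrite /a /d.
  by move: l'_gt2; clear; lia.
rewrite ltnNge; apply/negP=> leF.
have ltYk : #|Y| < k.
  move: gtY; rewrite /a /d; move: ltY l'_gt2 k_gt1; clear.
  move: #|Y| => y ltY l'2 k1; set d := maxn 1 (k * l' - 1 - y) => gtY.
  have [le1|gt1] := leqP (l' - d) 1.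
    have e : maxn 1 (l' - d) = 1 by move: le1; clear; lia.
    by rewrite e muln1 in gtY.
  have le_kd : d < k * d by move: k1; rewrite /d; clear; nia.
  have : k * (l' - d) = k * l' - k * d by rewrite mulnBr.
  have : maxn 1 (l' - d) = l' - d by move: gt1; clear; lia.
  move: gtY le_kd; rewrite /d; clear -ltY; nia.
have [dis con] := comps_at_connectors g_sym sF.
have [||ps [/(negP (no_packing ps))]] // :=
  @packing_of_disjoint_paths V g k l (enum F) _ dis.
  rewrite -cardE; apply: leq_trans leF.
  by rewrite leq_pmulr.
move=> T; rewrite mem_enum => TF; have [TX conT nT T1] := FP T TF.
have [x xT] : exists x, x \in T by apply/card_gt0P; apply: ltnW.
have degT y : y \in T -> k * l' - 1 - #|Y| <= inner_deg g T y.
  by rewrite -nT => yT; apply: inner_deg_ge.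
apply: (path_of_connected g_sym g_irr conT xT degT).
  by move: ltYk l'_gt2 k_gt1 le_l; clear; nia.
rewrite ltnNge; apply/negP=> leT.
have Y1 : 1 < #|Y|.
  apply: (noblob TX _ (leq_trans leT le_l)); last by rewrite nT.
  by apply/set0Pn; exists x.
have : inner_deg g T x < #|T|.
  apply: proper_card; apply/properP; split.
    by apply/subsetP=> y; rewrite inE => /andP[].
  by exists x; rewrite // inE g_irr andbF.
have := degT x xT; move: leT le_l Y1 ltYk l'_gt2; clear; nia.
Qed.

End CommonNeighbourhood.

Lemma packing_of_long_path (V : eqType) (g : rel V) k l p :
  sorted g p -> uniq p -> k * l.+1 <= size p -> exists ps, path_packing g k l ps.
Proof.
move=> sp up szp; suff [ps [pack _]] : exists ps,
  path_packing g k l ps /\ {subset flatten ps <= p} by exists ps.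
elim: k p sp up szp => [|k IH] p sp up szp; first by exists [::].
have [|||ps [/and3P[/eqP szps allps ups] sps]] := IH (drop l.+1 p).
- exact: drop_sorted.
- exact: drop_uniq.
- by rewrite size_drop; lia.
exists (take l.+1 p :: ps); split; last first.
  by move=> x; rewrite /= mem_cat => /orP[/mem_take|/sps/mem_drop].
apply/and3P; split=> /=; first by rewrite szps.
  by rewrite allps take_sorted // size_takel ?eqxx //; lia.
rewrite cat_uniq take_uniq // ups andbT; apply/hasPn=> x /sps xd.
move: up; rewrite -{1}(cat_take_drop l.+1 p) cat_uniq => /and3P[_ /hasPn + _].
exact.
Qed.

(** There are many components with a common neighbourhood [Y].  If [Y] had
    [k * l'] vertices or more, [k] paths could be threaded through it, and only
    few components have two vertices or more.  The others are single vertices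
    whose neighbourhood is [Y], so the minimum degree gives the size of [Y]. *)
Lemma common_neighbourhood k l l' M :
    1 < k -> 2 < l' -> l <= l'.*2 -> 0 < M ->
  exists N, forall (V : finType) (g : rel V) (X : {set V}),
    symmetric g -> irreflexive g -> (forall x y, g x y -> y \in X) ->
    {in X, forall x, k * l' - 1 <= #|[set y | g x y]|} ->
    (forall ps, ~~ path_packing g k l ps) -> no_blob g X l'.*2 ->
    N <= #|X| ->
  exists U W : {set V}, [/\ U \subset X, #|U| = k * l' - 1, W \subset X, M <= #|W|
                         & {in W, forall w, [set y | g w y] = U}].
Proof.
move=> k_gt1 l'_gt2 le_l M_gt0.
have [N HN] := many_components (k * l.+1) 0 (k * l'.+1 + M).
exists N => V g X g_sym g_irr g_in_X min_deg no_packing noblob leN.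
have [||C [Y [CX leF]]] := HN V g X g_sym _ _ leN.
- rewrite leqn0 cards_eq0; apply/eqP/setP=> y; rewrite !inE.
  by apply/negP=> /andP[/negP yX /exists_inP[x _ /g_in_X]].
- move=> x xX; exists x => [|q pq uq]; first exact: comp_refl.
  rewrite ltnNge; apply/negP=> leq; move: pq; rewrite restr_path // => /andP[pq _].
  have [|ps] := @packing_of_long_path _ g k l (x :: q) pq uq; last first.
    exact/negP/no_packing.
  exact: leq_trans leq (leqnSn _).
have ltY : #|Y| < k * l'.
  rewrite ltnNge; apply/negP=> leY.
  have l'_gt0 : 0 < l' by apply: leq_trans l'_gt2.
  have := @comps_at_few _ g k l g_sym g_irr no_packing C Y _ l' 0
    (subxx _) l'_gt0 le_l leY.
  by rewrite ltnNge (leq_trans _ leF) ?leq_addr // => /(_ (fun _ _ _ _ => isT)).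
have few := few_large_comps g_sym g_irr k_gt1 l'_gt2 le_l min_deg no_packing noblob CX ltY.
pose F1 := [set T in comps_at g C Y | #|T| <= 1].
have leF1 : M <= #|F1|.
  have : comps_at g C Y = [set T in comps_at g C Y | 1 < #|T|] :|: F1.
    by apply/setP=> T; rewrite !inE -andb_orr [_ <= 1]leqNgt orbN andbT.
  have [+ _] := leq_card_setU [set T in comps_at g C Y | 1 < #|T|] F1.
  by move=> + e; rewrite -e; move: few leF; clear; lia.
pose W := [set w in C | [set w] \in F1].
have WP w : w \in W -> [set y | g w y] = Y.
  rewrite inE => /andP[wC]; rewrite inE => /andP[/imsetP[x]].
  rewrite inE => /andP[xC /eqP nT] eT _; rewrite -nT -eT.
  apply/setP=> y; rewrite !inE; apply/idP/andP=> [gwy|[_ /exists_inP[z /set1P->]] //].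
  split; last by apply/exists_inP; exists w; rewrite ?inE.
  by apply: contraTneq gwy => ->; rewrite g_irr.
have F1W : F1 \subset set1 @: W.
  apply/subsetP=> T TF1; have := TF1; rewrite inE => /andP[/imsetP[x]].
  rewrite inE => /andP[xC _] eT; rewrite leq_eqVlt ltnS leqn0 cards_eq0.
  case/orP=> [/cards1P[w eTw]|/eqP T0]; last first.
    by have := comp_refl g C x; rewrite -eT T0 inE.
  have wC : w \in C.
    by apply: (subsetP (comp_sub g xC)); rewrite -eT eTw inE.
  by apply/imsetP; exists w; rewrite // inE wC -eTw.
have leW : M <= #|W|.
  by apply: leq_trans leF1 (leq_trans (subset_leq_card F1W) (leq_imset_card _ _)).
have WX : W \subset X.
  by apply/subsetP=> w; rewrite inE => /andP[/(subsetP CX)].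
have [w wW] : exists w, w \in W by apply/card_gt0P; apply: leq_trans leW.
have eY := WP w wW.
exists Y, W; split=> //.
- by apply/subsetP=> y; rewrite -eY inE => /g_in_X.
- have := min_deg w (subsetP WX w wW); rewrite eY; move: ltY; clear; lia.
Qed.

(** * Edges outside the common neighbourhood *)

Section Outside.

Variables (V : finType) (g : rel V) (X U W : {set V}) (k l l' : nat).
Hypotheses (g_sym : symmetric g) (g_irr : irreflexive g).
Hypothesis g_in_X : forall x y, g x y -> y \in X.
Hypotheses (k_gt1 : 1 < k) (l'_gt2 : 2 < l').
Hypothesis le_l : l <= l'.*2.
Hypothesis min_deg : {in X, forall x, k * l' - 1 <= #|[set y | g x y]|}.
Hypothesis no_packing : forall ps, ~~ path_packing g k l ps.
Hypothesis noblob : no_blob g X l'.*2.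
Hypothesis card_U : #|U| = k * l' - 1.
Hypothesis card_W : k * l'.+1 + l + 6 <= #|W|.
Hypothesis W_nbrs : {in W, forall w, [set y | g w y] = U}.

Lemma W_adj w u : w \in W -> u \in U -> g u w.
Proof. by move=> wW; rewrite -(W_nbrs wW) inE g_sym. Qed.

Lemma W_notin_U w : w \in W -> w \notin U.
Proof. by move=> wW; rewrite -(W_nbrs wW) inE g_irr. Qed.

Lemma singleton_connectors (ws : seq V) (Y : {set V}) :
    uniq ws -> {subset ws <= W} -> Y \subset U ->
  pairwise_disjoint (map set1 ws) /\
  {in map set1 ws, forall T, connector g Y T}.
Proof.
move=> uws wsW YU; split.
  rewrite /pairwise_disjoint pairwise_map; move: uws; rewrite uniq_pairwise.
  by apply: sub_pairwise => x y /=; rewrite disjoints1 inE.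
move=> _ /mapP[w /wsW wW ->]; split.
- by move=> x y /set1P-> /set1P->.
- by rewrite disjoints1; apply: contra (W_notin_U wW) => /(subsetP YU).
- by move=> y /(subsetP YU) yU; exists w; rewrite ?inE ?W_adj.
Qed.

Lemma covered_singletons (ws : seq V) x : covered (map set1 ws) x -> x \in ws.
Proof. by case/hasP=> _ /mapP[w wws ->] /set1P->. Qed.

(** The path leaves [(k - 1) * l'] vertices of [U] untouched, and these carry
    [k - 1] further paths that alternate between [U] and [W]. *)
Lemma spare_path P : sorted g P -> uniq P -> l < size P ->
  #|U :&: [set x in P]| < l' -> False.
Proof.
move=> sP uP szP fewU.
pose Q := take l.+1 P; pose Y := U :\: [set x in Q].
have szQ : size Q = l.+1 by rewrite size_takel.
have cQ : #|[set x in Q]| <= l.+1 by rewrite cardsE (leq_trans (card_size _)) ?szQ.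
have cY : k.-1 * l' <= #|Y|.
  have : #|U :&: [set x in Q]| <= #|U :&: [set x in P]|.
    by apply/subset_leq_card/setIS/subsetP=> x; rewrite !inE => /mem_take.
  rewrite cardsD card_U; move: fewU k_gt1; clear.
  by case: k => // k'; rewrite mulSn /=; lia.
pose ws := enum (W :\: [set x in Q]).
have szws : k.-1 * l'.+1 <= size ws.
  rewrite -cardE cardsD.
  have : #|W :&: [set x in Q]| <= l.+1.
    by apply: leq_trans cQ; apply/subset_leq_card/subsetIr.
  by move: card_W k_gt1; clear; case: k => // k'; rewrite mulSn /=; lia.
have [dis con] := @singleton_connectors ws Y (enum_uniq _)
  (fun x => ltac:(by rewrite mem_enum inE => /andP[])) (subsetDl _ _).
have l'_gt0 : 0 < l' by apply: leq_trans l'_gt2.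
have [|||ps [/and3P[/eqP szps allps ups] sps]] :=
  @path_packing_of_connectors V g g_sym g_irr Y (enum Y) (map set1 ws) l' 0 k.-1 l
    l'_gt0 le_l (enum_uniq _) _ _ _ dis con (fun _ _ _ _ => isT).
- by move=> x; rewrite mem_enum.
- by rewrite -cardE.
- by rewrite size_map.
apply/negP: (no_packing (Q :: ps)); rewrite negbK; apply/and3P; split.
- by rewrite /= szps; case: k k_gt1.
- by rewrite /= szQ eqxx take_sorted.
- rewrite /= cat_uniq take_uniq // ups andbT; apply/hasPn=> x /sps.
  case/orP=> [|/covered_singletons]; rewrite mem_enum !inE => /andP[+ _] //.
Qed.

(** Between [y1] and [y2], a path alternates between [l' - 1] vertices of [U]
    and [l' - 2] vertices of [W].  Prolonged by [f] and [b], it has few enough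
    vertices of [U] for [spare_path], so it has at most [l] vertices. *)
Lemma path_through_U y1 y2 f b : y1 \in U -> y2 \in U -> y1 != y2 ->
    path g y1 f -> path g y2 b -> uniq (f ++ b) ->
    {in f ++ b, forall x, x \notin U} -> size (f ++ b) <= 4 ->
  size (f ++ b) + l'.*2 < l + 4.
Proof.
move=> y1U y2U y12 pf pb ufb fbU szfb; rewrite ltnNge; apply/negP=> long.
pose ys := rcons (take (l' - 3) (enum (U :\ y1 :\ y2))) y2.
have szys : size ys = l' - 2.
  rewrite size_rcons size_takel; first by move: l'_gt2; clear; lia.
  have := cardsD1 y1 U; have := cardsD1 y2 (U :\ y1).
  rewrite -cardE card_U y1U !inE eq_sym y12 y2U.
  by move: k_gt1; clear; nia.
have uys : uniq (y1 :: ys).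
  rewrite /ys /= mem_rcons inE negb_or y12 rcons_uniq take_uniq ?enum_uniq // andbT.
  by apply/andP; split; apply: contraT; rewrite negbK => /mem_take;
    rewrite mem_enum !inE eqxx ?andbF.
have ysU : {subset y1 :: ys <= U}.
  move=> x; rewrite inE mem_rcons inE => /or3P[/eqP->|/eqP->|/mem_take] //.
  by rewrite mem_enum !inE => /and3P[].
pose ws := take (l' - 2) (enum (W :\: [set x in f ++ b])).
have szws : size ws = l' - 2.
  rewrite size_takel // -cardE cardsD.
  have : #|W :&: [set x in f ++ b]| <= 4.
    apply: leq_trans szfb; apply: leq_trans (subset_leq_card (subsetIr _ _)) _.
    by rewrite cardsE card_size.
  by move: card_W k_gt1; clear; nia.
have wsP x : x \in ws -> (x \in W) && (x \notin f ++ b).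
  by move/mem_take; rewrite mem_enum !inE andbC.
have [dis con] := @singleton_connectors ws U (take_uniq _ (enum_uniq _))
  (fun x xws => proj1 (andP (wsP x xws))) (subxx U).
have [|||P [sP uP szP inP]] := @path_with_ends V g g_sym U y1 ys (map set1 ws) f b
  _ uys ysU dis con pf _ ufb _.
- by rewrite size_map szws szys.
- by rewrite last_rcons.
- move=> x xfb; rewrite fbU //=; apply/negP=> /covered_singletons/wsP/andP[_].
  by rewrite xfb.
apply: (@spare_path P) => //.
  apply: leq_trans szP; rewrite szys -size_cat; move: long l'_gt2; clear; lia.
apply: leq_ltn_trans (_ : size (y1 :: ys) < _); last first.
  by rewrite /= szys; move: l'_gt2; clear; lia.
apply: leq_trans (card_size _); apply/subset_leq_card/subsetP=> x.
rewrite !inE => /andP[xU /inP/or3P[/fbU|//|/covered_singletons/wsP/andP[xW _]]].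
  by rewrite xU.
by have := W_notin_U xW; rewrite xU.
Qed.

Lemma attached_path u q : u \in U -> path g u q -> uniq q ->
    {in q, forall x, x \notin U} -> size q <= 3 ->
  size q + l'.*2 < l + 3.
Proof.
move=> uU pq uq qU szq.
have [u2 /setD1P[u2u u2U]] : exists u2, u2 \in U :\ u.
  apply/card_gt0P; have := cardsD1 u U; rewrite uU card_U.
  by move: k_gt1 l'_gt2; clear; nia.
have [w /setDP[wW]] : exists w, w \in W :\: [set x in q].
  apply/card_gt0P; rewrite cardsD.
  have : #|W :&: [set x in q]| <= 3.
    apply: leq_trans szq; apply: leq_trans (subset_leq_card (subsetIr _ _)) _.
    by rewrite cardsE card_size.
  by move: card_W; clear; lia.
rewrite inE => wq.
have := @path_through_U u u2 q [:: w] uU u2U _ pq _ _ _ _.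
rewrite size_cat /= addn1 addSn addnS ltnS; apply=> //.
- by rewrite eq_sym.
- by rewrite W_adj.
- by rewrite cats1 rcons_uniq wq.
- by move=> x; rewrite cats1 mem_rcons inE => /predU1P[->|/qU//]; apply: W_notin_U.
Qed.

(** Otherwise the component of [x] outside [U] has no neighbour at all.  Its
    minimum degree then makes it contain a path with [l] edges that avoids [U],
    or be so small that it contradicts [no_blob]. *)
Lemma attached_in_comp x : x \in X -> x \notin U ->
  exists c u, [/\ c \in comp g (X :\: U) x, u \in U & g u c].
Proof.
move=> xX xU; set T := comp g (X :\: U) x.
have xC : x \in X :\: U by rewrite inE xU.
have [/exists_inP[c cT /exists_inP[u uU guc]]|/exists_inPn none] :=
  boolP [exists c in T, [exists u in U, g u c]].
  by exists c, u.
have TC : T \subset X :\: U := comp_sub g xC.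
have TX : T \subset X := subset_trans TC (subsetDl _ _).
have nT : nbhd g T = set0.
  apply/eqP; rewrite -subset0; apply/subsetP=> z.
  rewrite inE => /andP[zT /exists_inP[y yT gyz]].
  have zU : z \notin U.
    apply/negP=> zU; have /exists_inPn/(_ z zU) := none y yT.
    by rewrite g_sym gyz.
  have zC : z \in X :\: U by rewrite inE zU (g_in_X gyz).
  by have := comp_closed yT (subsetP TC y yT) zC gyz; rewrite -/T (negPf zT).
have degT : {in T, forall y, k * l' - 1 <= inner_deg g T y}.
  by move=> y yT; have := inner_deg_ge min_deg yT TX; rewrite nT cards0 subn0.
have ltT : l < #|T|.
  rewrite ltnNge; apply/negP=> leT.
  have T0 : T != set0 by apply/set0Pn; exists x; apply: comp_refl.
  have : 1 < #|@set0 V|.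
    by apply: (noblob TX T0 (leq_trans leT le_l)); rewrite nT.
  by rewrite cards0.
have [|q [sq uq qT szq]] := path_of_connected g_sym g_irr
    (comp_connected g_sym xC) (comp_refl g _ x) degT _ ltT.
  by move: le_l k_gt1 l'_gt2; clear; nia.
exfalso; apply: (@spare_path q) => //; first by rewrite szq.
rewrite (_ : _ :&: _ = set0) ?cards0 ?(leq_trans _ l'_gt2) //.
apply/setP=> y; rewrite !inE; apply/negP=> /andP[yU /qT/(subsetP TC)].
by rewrite inE yU.
Qed.

(** Let [c] be a vertex attached to [U] in the component of [x].  An edge [c c']
    outside [U] gives a path of two vertices attached to [U], which is too long
    unless [l] is even; a path of three vertices attached to [U] is always too
    long, so [c'] has no other neighbour outside [U].  It is therefore attached to [U]
    as well, and by symmetry the component is [{c, c'}]. *)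
Lemma outer_edge x x' : x \notin U -> x' \notin U -> g x x' ->
  l = l'.*2 /\ forall z, z \notin U -> g x z -> z = x'.
Proof.
move=> xU x'U gxx'; have xX : x \in X by apply: (g_in_X (x := x')); rewrite g_sym.
have [c [u [cT uU guc]]] := attached_in_comp xX xU.
set T := comp g (X :\: U) x in cT.
have xC : x \in X :\: U by rewrite inE xU.
have TC : T \subset X :\: U := comp_sub g xC.
have conT : connected_in g T := comp_connected g_sym xC.
have TU y : y \in T -> y \notin U by move/(subsetP TC); rewrite inE => /andP[].
have Tclosed y z : y \in T -> z \notin U -> g y z -> z \in T.
  move=> yT zU gyz; apply: (comp_closed yT (subsetP TC y yT) _ gyz).
  by rewrite inE zU (g_in_X gyz).
have xT : x \in T := comp_refl g _ x.
have x'T : x' \in T := Tclosed x x' xT x'U gxx'.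
have xx' : x != x' by apply: contraTneq gxx' => ->; rewrite g_irr.
have [c' c'T gcc'] : exists2 c', c' \in T & g c c'.
  have [t tT tc] : exists2 t, t \in T & t != c.
    by have [e|] := eqVneq x c; [exists x'; rewrite // -e eq_sym | exists x].
  have [a [b [_ bT /eqP-> _ gab]]] :=
    connected_exit (A := pred1 c) conT cT tT (eqxx c) tc.
  by exists b.
have cc' : c != c' by apply: contraTneq gcc' => ->; rewrite g_irr.
have evenl : l = l'.*2.
  have := @attached_path u [:: c; c'] uU; rewrite /= guc gcc' inE cc'.
  have cU : {in [:: c; c'], forall y, y \notin U}.
    by move=> y; rewrite !inE => /orP[]/eqP->; apply: TU.
  by move=> /(_ isT isT cU isT); move: le_l; clear; lia.
have only a a' v : a \in T -> a' \in T -> v \in U -> g v a -> g a a' ->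
    forall z, z \notin U -> g a' z -> z = a.
  move=> aT a'T vU gva gaa' z zU ga'z; apply/eqP; apply: contraT => za.
  have := @attached_path v [:: a; a'; z] vU; rewrite /= gva gaa' ga'z !inE negb_or.
  have -> : a' != z by apply: contraTneq ga'z => ->; rewrite g_irr.
  have -> : a != a' by apply: contraTneq gaa' => ->; rewrite g_irr.
  rewrite [a == z]eq_sym za; have aU : {in [:: a; a'; z], forall y, y \notin U}.
    by move=> y; rewrite !inE => /or3P[]/eqP-> //; apply: TU.
  by move=> /(_ isT isT aU isT); move: evenl; clear; lia.
have onlyc := only c c' u cT c'T uU guc gcc'.
have [u' u'U gu'c'] : exists2 u', u' \in U & g u' c'.
  have : 1 < #|[set y | g c' y]|.
    have c'X : c' \in X := g_in_X gcc'.
    by apply: leq_trans (min_deg c'X); move: k_gt1 l'_gt2; clear; nia.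
  rewrite (cardsD1 c) inE g_sym gcc' add1n ltnS => /card_gt0P[y].
  rewrite !inE => /andP[yc gc'y]; exists y; last by rewrite g_sym.
  by apply: contraNT yc => yU; apply/eqP/onlyc.
have onlyc' := only c' c u' c'T cT u'U gu'c' (etrans (g_sym c' c) gcc').
have Tcc' y : y \in T -> (y == c) || (y == c').
  move=> yT; apply: contraT => yN.
  have [a [b [_ bT Aa Ab gab]]] := connected_exit
    (A := fun y => (y == c) || (y == c')) conT cT yT (introT orP (or_introl (eqxx c))) yN.
  case/orP: Aa Ab gab => /eqP->; rewrite negb_or => /andP[bc bc'].
    by move/(onlyc' b (TU b bT))=> e; rewrite e eqxx in bc'.
  by move/(onlyc b (TU b bT))=> e; rewrite e eqxx in bc.
split=> // z zU gxz.
have := Tcc' x xT; have := Tcc' x' x'T; case/orP=> /eqP ex'; case/orP=> /eqP ex.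
- by rewrite ex ex' eqxx in xx'.
- by rewrite ex'; apply: onlyc => //; rewrite -ex.
- by rewrite ex'; apply: onlyc' => //; rewrite -ex.
- by rewrite ex ex' eqxx in xx'.
Qed.

Lemma outer_edge_nbr (A : {set V}) x x' : #|A| <= 1 ->
    x \notin U -> x' \notin U -> g x x' ->
  exists u, [/\ u \in U, u \notin A & g u x].
Proof.
move=> cA xU x'U gxx'.
have [_ only] := outer_edge xU x'U gxx'.
have xX : x \in X by apply: (g_in_X (x := x')); rewrite g_sym.
have [y] : exists y, y \in [set y | g x y] :\: (x' |: A).
  apply/card_gt0P; rewrite cardsD subn_gt0.
  apply: leq_trans (_ : 3 <= _); last first.
    by apply: leq_trans (min_deg xX); move: k_gt1 l'_gt2; clear; nia.
  rewrite ltnS; apply: leq_trans (subset_leq_card (subsetIr _ _)) _.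
  by rewrite cardsU1; move: cA; clear; case: (_ \notin _); lia.
rewrite !inE negb_or => /andP[/andP[yx' yA] gxy]; exists y; split=> //.
  by apply: contraNT yx' => yU; apply/eqP/only.
by rewrite g_sym.
Qed.

(** Two different edges would be disjoint, and could be used as the two ends of
    one path through [U].  Two such ends with two vertices each are too long. *)
Lemma outer_edges_eq x x' y y' : x \notin U -> x' \notin U -> g x x' ->
  y \notin U -> y' \notin U -> g y y' -> [set x; x'] = [set y; y'].
Proof.
move=> xU x'U gxx' yU y'U gyy'.
have gx'x : g x' x by rewrite g_sym.
have gy'y : g y' y by rewrite g_sym.
have [evenl onlyx] := outer_edge xU x'U gxx'.
have [_ onlyx'] := outer_edge x'U xU gx'x.
have [e|yx] := eqVneq y x; first by rewrite e in gyy' *; rewrite (onlyx y').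
have [e|yx'] := eqVneq y x'; first by rewrite e in gyy' *; rewrite (onlyx' y') // setUC.
have [e|y'x] := eqVneq y' x.
  by move: yx'; rewrite (onlyx y) ?eqxx // -e.
have [e|y'x'] := eqVneq y' x'.
  by move: yx; rewrite (onlyx' y) ?eqxx // -e.
have [u1 [u1U _ gu1x]] := outer_edge_nbr (leq_trans (eq_leq (cards0 V)) isT) xU x'U gxx'.
have [u2 [u2U u2u1 gu2y]] := outer_edge_nbr (eq_leq (cards1 u1)) yU y'U gyy'.
have xx' : x != x' by apply: contraTneq gxx' => ->; rewrite g_irr.
have yy' : y != y' by apply: contraTneq gyy' => ->; rewrite g_irr.
have := @path_through_U u1 u2 [:: x; x'] [:: y; y'] u1U u2U.
rewrite inE eq_sym in u2u1; rewrite u2u1 /= gu1x gxx' gu2y gyy' !inE !negb_or.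
rewrite xx' yy' ![_ == y]eq_sym ![_ == y']eq_sym yx yx' y'x y'x'.
have fbU : {in [:: x; x'; y; y'], forall z, z \notin U}.
  by move=> z; rewrite !inE => /or4P[]/eqP->.
by move=> /(_ isT isT isT isT fbU isT); move: evenl; clear; lia.
Qed.

End Outside.

(** Without an edge outside [U], any two vertices of [W] serve as [D]. *)
Lemma structure_of_min_degree k l l' :
    1 < k -> 2 < l' -> l <= l'.*2 ->
  exists N, forall (V : finType) (g : rel V) (X : {set V}),
    symmetric g -> irreflexive g -> (forall x y, g x y -> y \in X) ->
    {in X, forall x, k * l' - 1 <= #|[set y | g x y]|} ->
    (forall ps, ~~ path_packing g k l ps) -> no_blob g X l'.*2 ->
    N <= #|X| ->
  exists U D : {set V},
    [/\ U \subset X, #|U| = k * l' - 1, D \subset X :\: U, #|D| = 2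
     & forall x y, g x y -> [|| x \in U, y \in U | ~~ odd l && ([set x; y] == D)]].
Proof.
move=> k1 l'2 le_l.
have [|N HN] := common_neighbourhood (M := k * l'.+1 + l + 6) k1 l'2 le_l _.
  by rewrite addnS.
exists N => V g X g_sym g_irr g_in_X min_deg no_packing noblob leN.
have [U [W [UX cU WX cW WU]]] := HN V g X g_sym g_irr g_in_X min_deg no_packing noblob leN.
case: (boolP [exists x, [exists y, [&& x \notin U, y \notin U & g x y]]]).
  case/existsP=> x /existsP[x' /and3P[xU x'U gxx']].
  have xX : x \in X by apply: (g_in_X x'); rewrite g_sym.
  exists U, [set x; x']; split=> //.
  - by rewrite subUset !sub1set !inE xU x'U xX (g_in_X _ _ gxx').
  - by rewrite cards2 (_ : x != x') //; apply: contraTneq gxx' => ->; rewrite g_irr.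
  - move=> y y' gyy'; case yU: (y \in U) => //=; case y'U: (y' \in U) => //=.
    have [e _] := outer_edge g_sym g_irr g_in_X k1 l'2 le_l min_deg no_packing
      noblob cU cW WU xU x'U gxx'.
    rewrite e odd_double /=; apply/eqP.
    exact: (outer_edges_eq g_sym g_irr g_in_X k1 l'2 le_l min_deg no_packing
      noblob cU cW WU (negbT yU) (negbT y'U) gyy' xU x'U gxx').
move/existsPn=> none.
have : 1 < #|W| by apply: leq_trans cW; rewrite !addnS.
case/card_gt1P=> w [w' [wW w'W ww']].
have WnU v : v \in W -> v \in X :\: U.
  by move=> vW; rewrite inE (subsetP WX) // andbT -(WU v vW) inE g_irr.
exists U, [set w; w']; split=> //.
- by rewrite subUset !sub1set !WnU.
- by rewrite cards2 ww'.
- move=> x y gxy; have /existsPn/(_ y) := none x; rewrite gxy andbT.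
  by rewrite negb_and !negbK => /orP[]->; rewrite ?orbT.
Qed.

(** * The extremal family *)

Definition extremal (V : finType) (X U D : {set V}) (b : bool) (r : nat) :
    {set {set V}} :=
  [set K : {set V} | [&& K \subset X, #|K| == r
                       & (#|K :\: U| <= 1) || b && (K :\: U == D)]].

Section Extremal.

Variable V : finType.
Implicit Types (A X U D E K e : {set V}) (Q R : {set {set V}}).

Lemma setU_D_disjoint U E A : [disjoint E & U] -> A \subset U ->
  (E :|: A) :\: U = E.
Proof.
move=> dEU AU; rewrite setDUl (eqP (_ : A :\: U == set0)) ?setD_eq0 // setU0.
by apply/setDidPl.
Qed.

Lemma card_setU_disjoint U E A : [disjoint E & U] -> A \subset U ->
  #|E :|: A| = #|E| + #|A|.
Proof.
move=> dEU AU; rewrite cardsU (_ : E :&: A = set0) ?cards0 ?subn0 //.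
by apply: disjoint_setI0; rewrite disjoint_sym (disjointWl AU) // disjoint_sym.
Qed.

Lemma card_fixed_trace U E r : [disjoint E & U] -> #|E| <= r ->
  #|[set K : {set V} | (#|K| == r) && (K :\: U == E)]| = 'C(#|U|, r - #|E|).
Proof.
move=> dEU leEr; rewrite -cards_draws.
rewrite -[RHS](@card_in_imset _ _ (fun A : {set V} => E :|: A)); last first.
  move=> A B; rewrite !inE => /andP[AU _] /andP[BU _] eAB.
  have trace (C : {set V}) : C \subset U -> (E :|: C) :&: U = C.
    move=> CU; rewrite setIUl (disjoint_setI0 dEU) set0U; exact/setIidPl.
  by rewrite -(trace A AU) -(trace B BU) eAB.
apply: eq_card => K; rewrite !inE; apply/andP/imsetP => [[/eqP cK /eqP KE]|].
  exists (K :&: U); last by rewrite -KE setUC setID.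
  by rewrite !inE subsetIr -KE -cK -(cardsID U K) addnK /=.
case=> A; rewrite inE => /andP[AU /eqP cA] ->.
by rewrite (setU_D_disjoint dEU) // (card_setU_disjoint dEU) // cA subnKC.
Qed.

(** The three terms count the sets [K] by [K :\: U]: a single vertex, empty,
    or [D]. *)
Lemma card_extremal X U D b r : U \subset X -> D \subset X :\: U -> #|D| = 2 ->
    2 <= r ->
  #|extremal X U D b r|
    = 'C(#|U|, r - 1) * (#|X| - #|U|) + 'C(#|U|, r) + b * 'C(#|U|, r - 2).
Proof.
move=> UX DXU cD r2.
pose S1 := set1 @: (X :\: U); pose S2 := if b then [set D] else set0.
pose S := set0 |: (S1 :|: S2).
have dXU E : E \subset X :\: U -> [disjoint E & U].
  by move=> /disjointWl-> //; rewrite disjoint_sym -setI_eq0 setIDA setIC -setIDA setDv setI0.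
have SP E : (E \in S) = (E \subset X :\: U) && ((#|E| <= 1) || b && (E == D)).
  rewrite !inE /S2; apply/or3P/andP => [[/eqP->|/imsetP[x xXU ->]|]|].
  - by rewrite sub0set cards0.
  - by rewrite sub1set xXU cards1.
  - by case: (b); rewrite ?inE // => /eqP->; rewrite DXU eqxx orbT.
  case=> EXU /orP[|/andP[-> /eqP->]]; last by constructor 3; rewrite inE.
  rewrite leq_eqVlt ltnS leqn0 cards_eq0 => /orP[/cards1P[x eE]|->].
    by constructor 2; apply/imsetP; exists x; rewrite // -sub1set -eE.
  by constructor 1.
have inS K : K \in extremal X U D b r -> K :\: U \in S.
  by rewrite SP inE => /and3P[KX _ ->]; rewrite setSD.
rewrite -sum1_card (partition_big _ (mem S) inS) /=.
have inner E : E \in S ->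
    \sum_(K in extremal X U D b r | K :\: U == E) 1 = 'C(#|U|, r - #|E|).
  rewrite SP => /andP[EXU cE].
  have leE2 : #|E| <= r.
    apply: leq_trans r2; case/orP: cE => [/leq_trans->//|/andP[_ /eqP->]].
    by rewrite cD.
  rewrite -(card_fixed_trace (dXU E EXU) leE2) sum1_card; apply: eq_card => K.
  rewrite [RHS]inE unfold_in /= [K \in _]inE.
  case KE: (K :\: U == E); rewrite ?andbF // !andbT (eqP KE) cE andbT.
  rewrite andb_idl // => _; rewrite -(setID K U) (eqP KE) subUset.
  by rewrite (subset_trans (subsetIr _ _) UX) (subset_trans EXU) ?subsetDl.
rewrite (eq_bigr _ inner) big_setU1 /=; last first.
  rewrite !inE negb_or; apply/andP; split.
    apply/negP=> /imsetP[x _ /setP/(_ x)]; by rewrite !inE eqxx.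
  rewrite /S2; case: (b); rewrite inE // eq_sym -cards_eq0 cD //.
rewrite cards0 subn0 (eq_bigl [in [predU S1 & S2]]); last first.
  by move=> E; rewrite !inE.
rewrite bigU /=; last first.
  rewrite disjoint_subset; apply/subsetP=> _ /imsetP[x _ ->]; rewrite /S2 !inE.
  case: (b); rewrite ?inE //; apply/negP=> /eqP/(congr1 (fun A : {set V} => #|A|)).
  by rewrite cards1 cD.
rewrite big_imset /=; last by move=> x y _ _; apply: set1_inj.
under eq_bigr do rewrite cards1.
rewrite sum_nat_const cardsD (setIidPr UX) /S2.
have -> : \sum_(E in (if b then [set D] else set0)) 'C(#|U|, r - #|E|)
          = b * 'C(#|U|, r - 2).
  by case: (b); rewrite ?big_set1 ?big_set0 ?cD ?mul1n ?mul0n.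
by rewrite addnA [_ + 'C(_, _)]addnC [(_ - _) * _]mulnC addnAC addnC.
Qed.

End Extremal.

(** * The weight of a red-blue graph *)

Definition cliques (V : finType) (Q : {set {set V}}) (r : nat) : {set {set V}} :=
  [set K : {set V} | (#|K| == r) && (pairs K \subset Q)].

Definition within (V : finType) (F : {set {set V}}) (X : {set V}) : {set {set V}} :=
  [set K in F | K \subset X].

Section Weight.

Variables (V : finType) (Q R : {set {set V}}) (r : nat).
Hypotheses (QR : [disjoint Q & R]) (sQR : Q :|: R \subset pairs [set: V]).
Implicit Types (X U D T K e : {set V}).

Definition weight X : nat := #|within (cliques Q r) X| + #|within R X|.

Definition adj : rel V := fun x y => [set x; y] \in Q :|: R.

Lemma adj_sym : symmetric adj.
Proof. by move=> x y; rewrite /adj setUC. Qed.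

Lemma adj_irr : irreflexive adj.
Proof.
move=> x; apply/negP=> /(subsetP sQR); rewrite inE => /andP[_].
by rewrite cards2 eqxx.
Qed.

Lemma card_pairs K : #|pairs K| = 'C(#|K|, 2).
Proof. by rewrite cards_draws. Qed.

Lemma clique_adj K x y : K \in cliques Q r -> x \in K -> y \in K -> x != y -> adj x y.
Proof.
rewrite inE => /andP[_ /subsetP sK] xK yK xy.
by rewrite /adj inE sK // inE subUset !sub1set xK yK cards2 xy.
Qed.

Lemma edge_pair e : e \in R -> exists x y, [/\ x != y, e = [set x; y] & adj x y].
Proof.
move=> eR; have eQR : e \in Q :|: R by rewrite inE eR orbT.
have := subsetP sQR e eQR; rewrite inE => /andP[_ /cards2P[x [y [xy ee]]]].
by exists x, y; split=> //; rewrite /adj -ee.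
Qed.

(** The blue cliques form a subfamily [B] of the extremal family.  A red edge
    lies in at least ['C(r, 2)] members of the family, one for each choice of
    [r - 2] further vertices among the [r] or more left in [U], and none of
    these members is in [B].  A member contains at most ['C(r, 2)] red edges,
    so by double counting there are at most as many red edges as members
    outside [B]. *)
Lemma weight_le_extremal X U D b : 2 <= r -> r + 2 <= #|U| -> U \subset X ->
    (forall x y, x \in X -> y \in X -> adj x y ->
       [|| x \in U, y \in U | b && ([set x; y] == D)]) ->
  weight X <= #|extremal X U D b r|.
Proof.
move=> r2 leU UX out.
set ext := extremal X U D b r; set B := within (cliques Q r) X; set S := within R X.
have BP K : K \in B -> K \in ext.
  rewrite inE => /andP[KQ KX]; rewrite inE KX.
  have -> : #|K| == r by move: KQ; rewrite inE => /andP[].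
  rewrite /=; case: leqP => //= /card_gt1P[x [y [/setDP[xK xU] /setDP[yK yU] xy]]].
  have inK := subsetP KX.
  have outK z t : z \in K -> t \in K -> z \notin U -> t \notin U -> z != t ->
      b && ([set z; t] == D).
    move=> zK tK zU tU zt; have := out z t (inK z zK) (inK t tK) (clique_adj KQ zK tK zt).
    by rewrite (negPf zU) (negPf tU).
  have /andP[-> /eqP eD] := outK x y xK yK xU yU xy.
  rewrite -eD /=; apply/eqP/setP=> z; rewrite !inE.
  apply/andP/orP => [[zU zK]|[]/eqP-> //].
  have [->|zx] := eqVneq z x; first by left.
  have xz : x != z by rewrite eq_sym.
  have /andP[_ /eqP eD'] := outK x z xK zK xU zU xz.
  have /setP/(_ z) := etrans eD (esym eD').
  by rewrite !inE eqxx orbT (negPf zx) /= => ->; right.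
have many e : e \in S -> 'C(r, 2) <= #|[set K in ext | e \subset K]|.
  rewrite inE => /andP[eR eX]; have [x [y [xy ee gxy]]] := edge_pair eR.
  have ce : #|e| = 2 by rewrite ee cards2 xy.
  pose draw := [set A : {set V} | A \subset U :\: e & #|A| == r - 2].
  apply: leq_trans (_ : #|draw| <= _).
    rewrite cards_draws; apply: leq_trans (_ : 'C(r, r - 2) <= _).
      by rewrite bin_sub.
    apply: leq_bin2l; rewrite cardsD.
    have := subset_leq_card (subsetIr U e); rewrite ce.
    by move: leU; clear; lia.
  have dis (A : {set V}) : A \subset U :\: e -> e :&: A = set0.
    by rewrite subsetD => /andP[_]; rewrite disjoint_sym => /disjoint_setI0.
  rewrite -[#|draw|](@card_in_imset _ _ (fun A : {set V} => e :|: A)); last first.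
    move=> A A'; rewrite !inE => /andP[Ae _] /andP[A'e _] eAA.
    have trace (C : {set V}) : C \subset U :\: e -> (e :|: C) :\: e = C.
      by move=> /dis Ce; rewrite setDUl setDv set0U; apply/setDidPl; rewrite -setI_eq0 setIC Ce.
    by rewrite -(trace A Ae) -(trace A' A'e) eAA.
  apply/subset_leq_card/subsetP=> K /imsetP[A]; rewrite inE => /andP[AU /eqP cA] ->.
  have sAU : A \subset U := subset_trans AU (subsetDl _ _).
  rewrite !inE subsetUl andbT subUset eX (subset_trans sAU UX) cardsU dis //.
  rewrite cards0 subn0 ce cA subnKC // eqxx /= setDUl.
  have -> : A :\: U = set0 by apply/eqP; rewrite setD_eq0.
  rewrite setU0; have := out x y; rewrite -!sub1set gxy.
  have [xX yX] : x \in X /\ y \in X.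
    by split; apply: (subsetP eX); rewrite ee !inE eqxx ?orbT.
  rewrite !sub1set xX yX => /(_ isT isT isT); rewrite ee.
  have meets z : z \in [set x; y] -> z \in U -> #|[set x; y] :\: U| <= 1.
    move=> ze zU; rewrite -ltnS -ce ee; apply/proper_card/properP.
    by split; [exact: subsetDl | exists z; rewrite // inE zU].
  have [xU|xU] := boolP (x \in U); first by rewrite (meets x) ?inE ?eqxx.
  have [yU|yU] := boolP (y \in U); first by rewrite (meets y) ?inE ?eqxx ?orbT.
  case/andP=> -> /eqP eD; apply/orP; right; rewrite eD; apply/eqP/setP=> z.
  by rewrite inE andbC andb_idr // -eD !inE => /orP[]/eqP->.
have sBext : B \subset ext by apply/subsetP.
suff : #|S| <= #|ext :\: B|.
  by rewrite /weight -/B -/S cardsD (setIidPr sBext); have := subset_leq_card sBext; lia.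
have C_gt0 : 0 < 'C(r, 2) by rewrite bin_gt0.
rewrite -(leq_pmul2r C_gt0) -!sum_nat_const.
apply: leq_trans (_ : \sum_(e in S) \sum_(K in ext) (e \subset K) <= _).
  apply: leq_sum => e eS; apply: leq_trans (many e eS) _.
  rewrite -sum1_card big_mkcond [X in _ <= X]big_mkcond /=.
  apply: leq_sum => K _; rewrite inE.
  by case: (K \in ext); case: (e \subset K).
rewrite exchange_big /= (bigID (mem B)) /= big1 ?add0n; last first.
  move=> K /andP[_]; rewrite inE => /andP[]; rewrite inE => /andP[_ /subsetP sK] _.
  apply: big1 => e; rewrite inE => /andP[eR _]; apply/eqP; rewrite eqb0.
  apply/negP=> eK; have eQ : e \in Q.
    apply: sK; rewrite inE eK.
    by have [x [y [xy -> _]]] := edge_pair eR; rewrite cards2 xy.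
  by move: QR; rewrite disjoint_subset => /subsetP/(_ e eQ); rewrite inE /= eR.
rewrite [X in _ <= X](eq_bigl (fun K => (K \in ext) && (K \notin B))); last first.
  by move=> K; rewrite inE andbC.
apply: leq_sum => K /andP[]; rewrite inE => /and3P[_ /eqP cK _] _.
rewrite -cK -card_pairs -sum1_card [X in X <= _]big_mkcond [X in _ <= X]big_mkcond /=.
apply: leq_sum => e _; case: ifP => // eS; case: (boolP (e \subset K)) => // eK.
move: eS; rewrite inE => /andP[eR _].
by have [x [y [xy ee _]]] := edge_pair eR; rewrite inE eK ee cards2 xy.
Qed.

Lemma weight_delete X T (c1 c2 : nat) :
    #|[set K in within (cliques Q r) X | ~~ [disjoint K & T]]| <= c1 ->
    #|[set e in within R X | ~~ [disjoint e & T]]| <= c2 ->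
  weight X <= weight (X :\: T) + (c1 + c2).
Proof.
have split_touch F : #|within F X|
    <= #|within F (X :\: T)| + #|[set K in within F X | ~~ [disjoint K & T]]|.
  rewrite -(cardsID (within F (X :\: T))).
  apply: leq_add; apply: subset_leq_card; first exact: subsetIr.
  apply/subsetP=> K; rewrite !inE subsetD => /andP[h /andP[KF KX]].
  by move: h; rewrite KF KX.
move=> le1 le2; rewrite /weight.
have := split_touch (cliques Q r); have := split_touch R.
by move: le1 le2; clear; lia.
Qed.

Lemma weight_delete1 X x : x \in X ->
  weight X <= weight (X :\ x) + ('C(#|[set y in X | [set x; y] \in Q]|, r - 1)
                                 + #|[set y in X | [set x; y] \in R]|).
Proof.
move=> xX; apply: weight_delete.
  rewrite -cards_draws.
  apply: leq_trans (leq_imset_card (fun A => x |: A) _).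
  apply/subset_leq_card/subsetP=> K; rewrite !inE disjoint_sym disjoints1 negbK.
  case/andP=> /andP[/andP[/eqP cK /subsetP sK] /subsetP KX] xK.
  apply/imsetP; exists (K :\ x); last by rewrite setD1K.
  rewrite inE; apply/andP; split; last first.
    by rewrite -cK (cardsD1 x K) xK add1n subn1.
  apply/subsetP=> y /setD1P[yx yK]; rewrite inE KX //=; apply: sK.
  by rewrite inE subUset !sub1set xK yK cards2 (eq_sym x) yx.
apply: leq_trans (leq_imset_card (fun y => [set x; y]) _).
apply/subset_leq_card/subsetP=> e.
rewrite !inE disjoint_sym disjoints1 negbK => /andP[/andP[eR eX] xe].
have [y [z [yz ee _]]] := edge_pair eR; move: xe eX eR; rewrite ee subUset !sub1set !inE.
case/orP=> /eqP-> /andP[yX zX] eR.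
  by apply/imsetP; exists z; rewrite ?inE ?zX.
by apply/imsetP; exists y; rewrite ?inE ?yX /= setUC.
Qed.

Lemma weight_delete_blob X T (Z : {set V}) m : #|Z| <= m ->
    (forall x y, x \in T -> y \in X -> adj x y -> y \in Z) -> T \subset Z ->
  weight X <= weight (X :\: T) + ('C(m, r) + 'C(m, 2)).
Proof.
move=> cZ closed TZ; apply: weight_delete.
  apply: leq_trans (leq_bin2l r cZ); rewrite -cards_draws.
  apply/subset_leq_card/subsetP=> K; rewrite !inE => /andP[/andP[KQ KX]].
  case/pred0Pn=> x /andP[/= xK xT]; apply/andP; split; last by case/andP: KQ.
  apply/subsetP=> y yK; have [->|yx] := eqVneq y x; first exact: (subsetP TZ).
  apply: (closed x y xT (subsetP KX y yK)).
  by apply: (@clique_adj K) => //; rewrite ?inE // eq_sym.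
apply: leq_trans (leq_bin2l 2 cZ); rewrite -cards_draws.
apply/subset_leq_card/subsetP=> e; rewrite !inE => /andP[/andP[eR eX]].
have [y [z [yz ee gyz]]] := edge_pair eR; rewrite ee cards2 yz andbT.
rewrite ee subUset !sub1set in eX; case/andP: eX => yX zX.
case/pred0Pn=> x /andP[/=]; rewrite !inE subUset !sub1set => /orP[]/eqP-> xT.
  by rewrite (subsetP TZ) //= (closed y z xT).
by rewrite (subsetP TZ z) // andbT (closed z y xT) // adj_sym.
Qed.

End Weight.

(** * Binomial inequalities *)

Lemma bin_ge_self q s : 0 < q -> q < s -> s <= 'C(s, q).
Proof.
elim: s q => // s IH [|q] // _; rewrite binS ltnS leq_eqVlt => /predU1P[<-|lt].
  by rewrite binn binSn add1n.
rewrite -addn1 leq_add ?IH //.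
by rewrite bin_gt0; apply: ltnW; apply: ltnW.
Qed.

Lemma bin_add_le q b d : 0 < q -> q <= b.+1 -> 'C(b, q) + d <= 'C(b + d, q).
Proof.
case: q => // q _ leq; elim: d => [|d IH]; first by rewrite !addn0.
rewrite !addnS binS -addn1 leq_add // bin_gt0.
by apply: (@leq_trans b) => //; apply: leq_addr.
Qed.

(** A vertex with [b] blue and [d] red edges is in at most ['C(b, q) + d] cliques
    and red edges, for [q = r - 1]; below degree [s] this is less than the
    ['C(s, q)] sets that each outer vertex contributes to the extremal family. *)
Lemma bin_add_lt q s b d : 0 < q -> q < s -> b + d < s -> 'C(b, q) + d < 'C(s, q).
Proof.
move=> q0 qs bds; have [lt|ge] := leqP q b.+1.
  have := bin_add_le (s - b) q0 lt; rewrite subnKC; last by move: bds; clear; lia.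
  by move: bds; clear; lia.
rewrite bin_small ?add0n; last by apply: ltnW.
by apply: leq_trans (bin_ge_self q0 qs); move: bds; clear; lia.
Qed.

(** Up to the small second term, the left side is [m * m.+1 / (r * (r - 1))] times
    ['C(m.-1, r - 2)], and the right side is [m * (L - r + 1) / (r - 1)] times
    ['C(L.-1, r - 2)]; as [L >= 2 * r] the second factor wins. *)
Lemma blob_bound r L m : 2 < r -> r.*2 <= L -> r + 7 <= L -> 0 < m -> m <= L ->
  'C(m.+1, r) + 'C(m.+1, 2) < 'C(L.-1, r.-1) * m.
Proof.
case: r => [|[|r]] // r0; case: L => [|L] // leL leL7; case: m => // m _ lemL.
rewrite [_.-1]/= [_.-1]/=.
(* From here on [r], [L] and [m] are the former [r - 2], [L - 1] and [m - 1]. *)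
pose X := 'C(L, r).
have X_ge : L <= X.
  apply: bin_ge_self; move: leL r0; clear; lia.
have e1 : r.+2 * (r.+1 * 'C(m.+2, r.+2)) <= m.+2 * m.+1 * X.
  have h1 := mul_bin_diag m.+2 r.+1; have h2 := mul_bin_diag m.+1 r.
  rewrite mulnCA -h1 mulnCA -h2 mulnA leq_mul2l; apply/orP; right.
  exact: leq_bin2l.
have e2 : 2 * 'C(m.+2, 2) = m.+2 * m.+1.
  by have := mul_bin_diag m.+2 1; rewrite bin1.
have e3 : r.+1 * 'C(L, r.+1) = (L - r) * X := mul_bin_left L r.
move: e1 e2 e3; move: ('C(m.+2, r.+2)) ('C(m.+2, 2)) ('C(L, r.+1)) => a b c e1 e2 e3.
have key : 2 * L.+2 * X + r.+2 * r.+1 * L.+2 < 2 * r.+2 * (L - r) * X.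
  have [D eD] : exists D, L = D + r.+1 by exists (L - r.+1); move: leL; clear; lia.
  have PL : r.+2 * r.+1 * L.+2 < 2 * (r.+2 * r.+1 - 1) * L.
    by move: r0 leL7; clear; nia.
  have PD : r.+2 * r.+1 - 1 <= r.+1 * D - 1.
    by rewrite leq_sub2r // mulnC leq_mul2l /=; move: leL; rewrite eD; clear; lia.
  have -> : 2 * r.+2 * (L - r) * X = 2 * L.+2 * X + 2 * (r.+1 * D - 1) * X.
    rewrite -mulnDl; congr (_ * X); rewrite eD; move: r0 leL7; rewrite eD; clear.
    by nia.
  rewrite ltn_add2l; apply: leq_trans PL _.
  by apply: leq_mul => //; rewrite leq_mul2l.
have : 2 * r.+2 * r.+1 * (a + b) < 2 * r.+2 * r.+1 * (c * m.+1).
  apply: leq_ltn_trans (_ : m.+1 * (2 * L.+2 * X + r.+2 * r.+1 * L.+2) < _).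
    have h1 : 2 * r.+2 * r.+1 * a <= m.+1 * (2 * L.+2 * X).
      have : m.+2 * m.+1 * X <= L.+2 * m.+1 * X.
        by rewrite !leq_mul2r !ltnS -[m <= L]ltnS lemL !orbT.
      move: e1; clear; nia.
    have h2 : 2 * r.+2 * r.+1 * b <= m.+1 * (r.+2 * r.+1 * L.+2).
      have : m.+2 * m.+1 <= L.+2 * m.+1 by rewrite leq_mul2r !ltnS -[m <= L]ltnS lemL orbT.
      move: e2; clear; nia.
    by rewrite mulnDr mulnDr leq_add.
  have -> : 2 * r.+2 * r.+1 * (c * m.+1) = m.+1 * (2 * r.+2 * (L - r) * X).
    have -> : 2 * r.+2 * r.+1 * (c * m.+1) = 2 * r.+2 * m.+1 * (r.+1 * c) by nia.
    by rewrite e3; clear; nia.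
  by rewrite ltn_pmul2l.
by rewrite ltn_mul2l => /andP[].
Qed.

(** * The bound for graphs *)

Definition turan_value (s r : nat) (b : bool) (n : nat) : nat :=
  'C(s, r - 1) * (n - s) + 'C(s, r) + b * 'C(s, r - 2).

Lemma weight_le_pow (V : finType) (Q R : {set {set V}}) r (X : {set V}) :
  weight Q R r X <= 2 ^ #|X| + 2 ^ #|X|.
Proof.
by rewrite -card_powerset leq_add // subset_leq_card //; apply/subsetP=> K;
  rewrite !inE => /andP[].
Qed.

(** [X] maximizes [m.+1 * (w X - c * #|X|) + #|X|].  Deleting [T] from [X] does not
    increase this, and as [#|T| < m.+1] the last summand is absorbed: [T] costs
    at least [c * #|T|].  Comparing with the whole set shows that [w X - c * #|X|]
    is at least its value on the whole set, and larger by a constant fraction of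
    [#|V|] unless [X] is large. *)
Lemma peeling (V : finType) (w : {set V} -> nat) (c m : nat) :
  exists X : {set V},
    (forall T : {set V}, T \subset X -> #|T| <= m -> w (X :\: T) + c * #|T| <= w X) /\
    m.+1 * w [set: V] + #|V| <= m.+1 * (w X + c * (#|V| - #|X|)) + #|X|.
Proof.
pose phi X := m.+1 * (w X + c * (#|V| - #|X|)) + #|X|.
have [X _ maxX] := @arg_maxnP _ setT xpredT phi isT.
exists X; split=> [T TX cT|]; last first.
  by have := maxX setT isT; rewrite /phi cardsT subnn muln0 addn0.
have := maxX (X :\: T) isT; rewrite /phi cardsD (setIidPr TX).
have := max_card X; have := subset_leq_card TX.
move: (w X) (w (X :\: T)) #|V| #|X| #|T| cT => a a' n x t le_tm le_tx le_xn le_phi.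
have e : c * (n - (x - t)) = c * (n - x) + c * t by rewrite -mulnDr; congr (_ * _); lia.
rewrite leqNgt; apply/negP=> lt.
have : m.+1 * (a + c * (n - x)).+1 <= m.+1 * (a' + c * (n - (x - t))).
  by rewrite leq_mul2l /= e; move: lt; clear; lia.
by rewrite mulnS; move: le_phi le_tm le_tx; clear; lia.
Qed.

(** A counterexample yields a set [X] as in [peeling], with [c = 'C(s, r - 1)] and
    [w] the weight.  [X] is large since the weight of a bounded set is bounded,
    and the excess over [turan_value] persists on [X] because [turan_value]
    grows by exactly [c] per vertex. *)
Lemma graph_bound k l l' r :
    1 < k -> 2 < r -> r <= l' -> r + 7 <= l'.*2 -> l <= l'.*2 ->
  exists N, forall (V : finType) (Q R : {set {set V}}),
    [disjoint Q & R] -> Q :|: R \subset pairs [set: V] ->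
    (forall ps, ~~ path_packing (adj Q R) k l ps) -> N <= #|V| ->
  #|cliques Q r| + #|R| <= turan_value (k * l' - 1) r (~~ odd l) #|V|.
Proof.
move=> k1 r2 rl' rl'7 le_l.
have l'2 : 2 < l' by apply: leq_trans rl'.
have [N1 HN] := structure_of_min_degree k1 l'2 le_l.
pose s := k * l' - 1; pose c := 'C(s, r - 1); pose m := l'.*2.
have ge_s : m <= s.+1.
  by rewrite /m /s; move: k1 l'2; clear; nia.
pose N2 := maxn N1 s.
exists (m.+1 * (2 ^ N2 + 2 ^ N2 + c * s) + N2) => V Q R QR sQR nopack leN.
set n := #|V| in leN *.
rewrite leqNgt; apply/negP=> big.
pose w := weight Q R r.
have wT : w [set: V] = #|cliques Q r| + #|R|.
  by congr (_ + _); apply: eq_card => K; rewrite inE subsetT andbT.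
have [X [minX potX]] := peeling w c m.
rewrite -wT in big.
have leXn : #|X| <= n := max_card X.
have bigX : N2 <= #|X|.
  rewrite leqNgt; apply/negP=> smallX.
  have := weight_le_pow Q R r X; rewrite -/(w X).
  have : 2 ^ #|X| <= 2 ^ N2 by rewrite leq_exp2l // ltnW.
  have h : c * (n - #|X|) <= c * n by rewrite leq_mul2l leq_subr orbT.
  have h' : c * (n - s) = c * n - c * s by rewrite mulnBr.
  move: big; rewrite /turan_value -/s -/c => big lep lew.
  have h1 : m.+1 * (c * n - c * s).+1 <= m.+1 * w [set: V].
    by rewrite leq_mul2l -h' /=; move: big; clear; lia.
  have h2 : m.+1 * (w X + c * (n - #|X|)) <= m.+1 * (2 ^ N2 + 2 ^ N2 + c * n).
    by rewrite leq_mul2l /= leq_add //; move: lew lep; clear; lia.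
  have h3 : m.+1 * (c * n) <= m.+1 * (c * n - c * s) + m.+1 * (c * s).
    by rewrite -mulnDr leq_mul2l /=; clear; lia.
  move: potX leN smallX h1 h2 h3; rewrite -/n !mulnDr mulnS; clear; lia.
have [leN1X lesX] : N1 <= #|X| /\ s <= #|X|.
  by split; apply: leq_trans bigX; rewrite ?leq_maxl ?leq_maxr.
have bigwX : turan_value s r (~~ odd l) #|X| < w X.
  have : w [set: V] <= w X + c * (n - #|X|).
    rewrite -(leq_pmul2l (ltn0Sn m)); move: potX leXn; rewrite -/n; clear; lia.
  have : c * (n - s) = c * (n - #|X|) + c * (#|X| - s).
    by rewrite -mulnDr; congr (_ * _); move: lesX leXn; clear; lia.
  by move: big; rewrite /turan_value -/s -/c; clear; lia.
pose g := restr (adj Q R) X.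
have g_sym : symmetric g := restr_sym (@adj_sym _ Q R) X.
have g_irr : irreflexive g by move=> x; rewrite /g restrE (adj_irr sQR) !andbF.
have g_in_X x y : g x y -> y \in X by rewrite /g restrE => /and3P[].
have g_packing ps : ~~ path_packing g k l ps.
  apply: contra (nopack ps) => /and3P[szps allps ups]; apply/and3P; split=> //.
  apply: sub_all allps => p /andP[-> sp] /=; apply: sub_sorted sp => x y.
  by rewrite /g restrE => /and3P[].
have min_deg : {in X, forall x, s <= #|[set y | g x y]|}.
  move=> x xX; rewrite leqNgt; apply/negP=> small.
  have := minX [set x]; rewrite sub1set cards1 muln1 => /(_ xX).
  have -> : 1 <= m by rewrite /m; move: l'2; clear; lia.
  move/(_ isT); have := weight_delete1 r sQR xX; rewrite -/w.
  pose A := [set y in X | [set x; y] \in Q]; pose B := [set y in X | [set x; y] \in R].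
  have AB : #|A| + #|B| < s.
    apply: leq_ltn_trans small; have := cardsUI A B.
    rewrite (_ : A :&: B = set0) ?cards0 ?addn0 => [<-|].
      apply/subset_leq_card/subsetP=> y; rewrite !inE /g restrE xX /adj inE.
      by case/orP=> /andP[-> ->]; rewrite ?orbT.
    apply/setP=> y; rewrite !inE; apply/negP=> /andP[/andP[_ yQ] /andP[_ yR]].
    by move: QR; rewrite disjoint_subset => /subsetP/(_ _ yQ); rewrite inE /= yR.
  have := bin_add_lt (q := r - 1) _ _ AB; rewrite -/c.
  have -> : 0 < r - 1 by move: r2; clear; lia.
  have -> : r - 1 < s by move: ge_s rl'7; rewrite -/m; clear; lia.
  by move=> /(_ isT isT); rewrite -/A -/B; clear; lia.
have blob : no_blob g X l'.*2.
  move=> T Y TX T0 cT nTY; rewrite ltnNge; apply/negP=> cY.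
  have T_gt0 : 0 < #|T| by rewrite card_gt0.
  have cZ : #|T :|: Y| <= #|T|.+1.
    by have [+ _] := leq_card_setU T Y; move: cY; clear; lia.
  have := minX T TX cT.
  have del : w X <= w (X :\: T) + ('C(#|T|.+1, r) + 'C(#|T|.+1, 2)).
    apply: (weight_delete_blob r sQR cZ) (subsetUl _ _) => x y xT yX gxy.
    rewrite inE; case yT: (y \in T) => //=; apply: (subsetP nTY).
    rewrite inE yT; apply/exists_inP; exists x => //.
    by rewrite /g restrE (subsetP TX x xT) yX.
  have : 'C(#|T|.+1, r) + 'C(#|T|.+1, 2) < 'C(m.-1, r.-1) * #|T|.
    by apply: blob_bound => //; rewrite leq_double.
  have : 'C(m.-1, r.-1) * #|T| <= c * #|T|.
    rewrite leq_mul2r; apply/orP; right; rewrite /c subn1; apply: leq_bin2l.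
    by move: ge_s; clear; lia.
  by move: del; clear; lia.
have [U [D [UX cU DXU cD out]]] := HN V g X g_sym g_irr g_in_X min_deg g_packing blob leN1X.
suff : w X <= turan_value s r (~~ odd l) #|X| by rewrite leqNgt bigwX.
rewrite /turan_value /s -cU -(card_extremal _ UX DXU cD) ?(ltnW r2) //.
apply: (weight_le_extremal QR sQR (ltnW r2) _ UX) => [|x y xX yX gxy].
  by rewrite cU -/s; move: ge_s rl'7; rewrite -/m; clear; lia.
by apply: out; rewrite /g restrE xX yX.
Qed.

(** * The extremal number *)

(** Along each path, [l'] disjoint edges are selected, all of which meet [U]:
    every second edge, starting with the first one or, when one of these is the
    edge that joins the two vertices of [D], with the second one.  The vertices
    of [U] on these edges are distinct, and there are [k * l'] of them. *)
Lemma extremal_berge_free (V : finType) (X U D : {set V}) (b : bool) r k l l' :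
    #|D| = 2 -> l'.*2 + b <= l.+1 -> #|U| < k * l' ->
  berge_free (disjoint_copies k (path_graph l)) (extremal X U D b r).
Proof.
move=> cD le_l' ltU; apply/forallP=> B; apply/implyP=> sB; apply/negP.
case/existsP=> f /existsP[phi /and4P[/injectiveP injf _ /eqP phiB /forallP sub]].
pose F (i : 'I_k) t := f (i, inord t).
have F_inj i i' t t' : t <= l -> t' <= l -> F i t = F i' t' -> i = i' /\ t = t'.
  by move=> tl t'l /injf[-> /(congr1 val)]; rewrite /= !inordK ?ltnS.
have edgeP i t : t < l ->
    [|| F i t \in U, F i t.+1 \in U | b && ([set F i t; F i t.+1] == D)].
  move=> tl; pose e := [set (i, widen_ord (leqnSn l) (Ordinal tl)); (i, lift ord0 (Ordinal tl))].
  have eF : e \in disjoint_copies k (path_graph l).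
    by apply/copies_pathP; exists i, (Ordinal tl).
  have := sub e; rewrite eF /= imsetU1 imset_set1 subUset !sub1set.
  have -> : widen_ord (leqnSn l) (Ordinal tl) = inord t.
    by apply/val_inj; rewrite /= inordK // ltnS ltnW.
  have -> : lift ord0 (Ordinal tl) = inord t.+1.
    by apply/val_inj; rewrite /= inordK.
  rewrite -!/(F _ _) => /andP[tK t1K].
  have : phi e \in extremal X U D b r.
    by apply: (subsetP sB); rewrite -phiB imset_f.
  rewrite inE => /and3P[_ _ out].
  case tU: (F i t \in U) => //=; case t1U: (F i t.+1 \in U) => //=.
  have sK : [set F i t; F i t.+1] \subset phi e :\: U.
    by rewrite subUset !sub1set !inE tU t1U tK t1K.
  have c2 : #|[set F i t; F i t.+1]| = 2.
    rewrite cards2; case: eqP => // /F_inj[] //; first exact: ltnW.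
    by move=> _ /eqP; rewrite ltn_eqF.
  case/orP: out => [le1|/andP[-> /eqP eD]].
    by have := leq_trans (subset_leq_card sK) le1; rewrite c2.
  by rewrite /= eqEcard -{1}eD sK cD c2.
pose bad i := [exists t : 'I_l', (F i t.*2 \notin U) && (F i t.*2.+1 \notin U)].
pose shift i : nat := b && bad i.
have shift_hits i t : t < l' ->
    (F i (t.*2 + shift i) \in U) || (F i (t.*2 + shift i).+1 \in U).
  move=> tl'; rewrite /shift; case bi: (bad i); last first.
    rewrite andbF addn0; move/existsPn: bi => /(_ (Ordinal tl')) /=.
    by rewrite negb_and !negbK.
  case/existsP: bi => u /andP[uU u1U].
  have ul' := ltn_ord u.
  have := @edgeP i u.*2; rewrite (negPf uU) (negPf u1U) /=.
  have -> : u.*2 < l by move: le_l' ul'; clear; lia.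
  move/(_ isT)/andP=> [bT /eqP eD]; rewrite bT in le_l' *; rewrite addn1.
  have := @edgeP i t.*2.+1.
  have tl : t.*2.+1 < l by move: le_l' tl'; clear; lia.
  rewrite tl => /(_ isT)/or3P[->//|->|/andP[_ /eqP]]; first by rewrite orbT.
  rewrite -eD => eqF; have t2l : t.*2.+2 <= l by [].
  have hit v : v <= l -> F i v \in [set F i u.*2; F i u.*2.+1] ->
      v = u.*2 \/ v = u.*2.+1.
    have u1l : u.*2.+1 <= l by move: le_l' ul'; clear; lia.
    by move=> vl; rewrite !inE => /orP[]/eqP/F_inj h; [left|right];
      case: h => //; apply: ltnW.
  have := hit t.*2.+1 (ltnW t2l); have := hit t.*2.+2 t2l.
  by rewrite -eqF !inE !eqxx orbT => /(_ isT) + /(_ isT); clear; lia.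
pose pos i (t : nat) := if F i (t.*2 + shift i) \in U then t.*2 + shift i
                        else (t.*2 + shift i).+1.
pose G (u : 'I_k * 'I_l') := F u.1 (pos u.1 u.2).
have posl i t : t < l' -> pos i t <= l.
  move=> tl'; have : shift i <= b by rewrite /shift; case: (b) (bad i) => [] [].
  by rewrite /pos; move: le_l' tl'; clear; case: ifP; lia.
have G_inj : injective G.
  move=> [i t] [i' t'] /F_inj[||/= ei]; rewrite ?posl //.
  rewrite -{i'}ei => epos; congr (_, _); apply/val_inj => /=.
  by move: epos; rewrite /pos; clear; case: ifP; case: ifP; lia.
have : #|G @: [set: 'I_k * 'I_l']| <= #|U|.
  apply/subset_leq_card/subsetP=> _ /imsetP[[i t] _ ->].
  have := shift_hits i t (ltn_ord t); rewrite /G /pos /=.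
  by case: ifP => //= ->.
by rewrite card_imset // cardsT card_prod !card_ord leqNgt ltU.
Qed.

Lemma berge_upper_bound k l l' r :
    1 < k -> 2 < r -> r <= l' -> r + 7 <= l'.*2 -> l <= l'.*2 ->
  exists N, forall (V : finType) (H : {set {set V}}), N <= #|V| ->
    uniform r H -> berge_free (disjoint_copies k (path_graph l)) H ->
  #|H| <= turan_value (k * l' - 1) r (~~ odd l) #|V|.
Proof.
move=> k1 r2 rl' rl'7 le_l; have [N HN] := graph_bound k1 r2 rl' rl'7 le_l.
exists N => V H leN unifH freeH.
have [Q [R [phi [QR sQR inj phiP leH]]]] := red_blue H.
apply: leq_trans leH _; apply: leq_trans (HN V Q R QR sQR _ leN).
  rewrite leq_add2r; apply/subset_leq_card/subsetP=> K; rewrite !inE => /andP[KH ->].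
  by rewrite andbT; apply: (implyP (forallP unifH K)).
move=> ps; apply: contraL freeH => pack.
exact: (packing_berge (ltnW k1) inj phiP pack).
Qed.

Theorem theorem1p6 (l r k l' : nat) (def_l' : l' = (l + 1) %/ 2)
    (hk : 2 <= k) (hr : 3 <= r) (hl : r <= l') (hl2 : r + 7 <= 2 * l') :
  exists N : nat, forall n : nat, N < n ->
    ex_berge r n (disjoint_copies k (path_graph l))
    = 'C(k * l' - 1, r - 1) * (n - k * l' + 1) + 'C(k * l' - 1, r)
      + (if odd l then 0 else 1) * 'C(k * l' - 1, r - 2).
Proof.
have le_l : l <= l'.*2 by rewrite def_l'; lia.
have le_l' : l'.*2 + ~~ odd l <= l.+1 by rewrite def_l'; lia.
have hl2' : r + 7 <= l'.*2 by rewrite -mul2n.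
have [N HN] := berge_upper_bound hk hr hl hl2' le_l.
exists (N + k * l' + 2) => n ltn.
set s := k * l' - 1.
have s_lt : s < k * l' by rewrite /s; move: hk hr hl; clear; nia.
have -> : 'C(s, r - 1) * (n - k * l' + 1) + 'C(s, r)
          + (if odd l then 0 else 1) * 'C(s, r - 2)
        = turan_value s r (~~ odd l) n.
  rewrite /turan_value; congr (_ * _ + _ + _ * _); last by case: odd.
  by move: ltn s_lt; rewrite /s; clear; lia.
apply/eqP; rewrite eqn_leq; apply/andP; split.
  apply/bigmax_leqP=> H /andP[unifH freeH].
  by have := HN 'I_n H _ unifH freeH; rewrite card_ord; apply; move: ltn; clear; lia.
have /card_geqP[us [uus szus _]] : s + 2 <= #|[set: 'I_n]|.
  by rewrite cardsT card_ord; move: ltn s_lt; rewrite /s; clear; lia.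
pose U := [set x in take s us]; pose D := [set x in drop s us].
have := uus; rewrite -(cat_take_drop s us) cat_uniq => /and3P[ut /hasPn dis ud].
have cU : #|U| = s by rewrite cardsE (card_uniqP ut) size_takel // szus leq_addr.
have cD : #|D| = 2 by rewrite cardsE (card_uniqP ud) size_drop szus addKn.
have DU : D \subset [set: 'I_n] :\: U.
  by apply/subsetP=> x; rewrite !inE andbT => /dis.
rewrite -[X in turan_value _ _ _ X]card_ord -cardsT /turan_value -{1 2 3 4}cU.
rewrite -(card_extremal (~~ odd l) (subsetT U) DU cD (ltnW hr)).
apply: (leq_bigmax_cond (extremal [set: 'I_n] U D (~~ odd l) r)).
rewrite (extremal_berge_free _ _ cD le_l') ?cU // andbT.
by apply/forallP=> K; apply/implyP; rewrite inE => /and3P[].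
Qed.
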